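(* Let $n\ge 2$, let $k_1,\dots,k_n$ be nonnegative integers and $\lambda=\sum_{i=1}^nk_i\lambda_i$. Let $V_n(\lambda)=\overline{M}\subset\mathcal{C}_n$ be the polynomial realization of the irreducible $\mathfrak{sl}(n+1)$-module of highest weight $\lambda$ described in the context. Then, as a vector space, $V_n(\lambda)$ is spanned by $S_n(\lambda)$. Moreover, for every integer $r\ge 0$, the homogeneous subspace $(V_n(\lambda))_r=\overline{M}_r$ is spanned by $(S_n(\lambda))_r$.
   Context: $E_{i,j}$ denotes the matrix unit with $1$ in position $(i,j)$; the base field is $\mathbb{C}$; $\mathbb{N}=\{0,1,2,\dots\}$. The Cartan subalgebra of $\mathfrak{sl}(n+1)$ is spanned by $h_i=E_{n+2-i,n+2-i}-E_{n+1-i,n+1-i}$ ($1\le i\le n$), the positive root vectors are $E_{i,j}$ with $j<i$, and $\lambda_i(h_r)=\delta_{i,r}$ defines the fundamental weights. Construction. For $1\le m\le n$ let $\mathcal{C}_m=\mathbb{C}[x_{i,j}\mid 1\le j\le i\le m]$ and $c_m=-\frac{1}{m+1}\sum_{i=0}^{m-1}(m-i)k_{n-m+1+i}$. $\mathfrak{sl}(m+1)$ acts on $\mathcal{C}_m$ inductively. For $m=1$: $E_{1,2}=x_{1,1}^2\partial_{x_{1,1}}-k_nx_{1,1}$, $E_{2,1}=-\partial_{x_{1,1}}$, $E_{1,1}-E_{2,2}=2x_{1,1}\partial_{x_{1,1}}-k_n$. For $2\le m\le n$: make $\mathcal{C}_{m-1}$ a $\mathfrak{gl}(m)$-module by letting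 $\sum_{i=1}^mE_{i,i}$ act as the scalar $c_m$; view differential operators on $\mathcal{C}_{m-1}$ as operators on $\mathcal{C}_m$; put $\mathcal{D}_m=\sum_{s=1}^mx_{m,s}\partial_{x_{m,s}}$; and for $i\ne j$ in $\{1,\dots,m\}$ let $E_{i,j}|_{\mathcal{C}_m}=x_{m,i}\partial_{x_{m,j}}+E_{i,j}|_{\mathcal{C}_{m-1}}$, $(E_{i,i}-E_{j,j})|_{\mathcal{C}_m}=x_{m,i}\partial_{x_{m,i}}-x_{m,j}\partial_{x_{m,j}}+(E_{i,i}-E_{j,j})|_{\mathcal{C}_{m-1}}$, $E_{i,m+1}|_{\mathcal{C}_m}=x_{m,i}\mathcal{D}_m+c_mx_{m,i}+\sum_{r=1}^mx_{m,r}E_{i,r}|_{\mathcal{C}_{m-1}}$, $E_{m+1,i}|_{\mathcal{C}_m}=-\partial_{x_{m,i}}$, $(E_{m,m}-E_{m+1,m+1})|_{\mathcal{C}_m}=\mathcal{D}_m+x_{m,m}\partial_{x_{m,m}}+c_m+E_{m,m}|_{\mathcal{C}_{m-1}}$. Put $V^{(1)}=\mathrm{Span}\{x_{1,1}^i\mid 0\le i\le k_n\}\subset\mathcal{C}_1$ and $V^{(m)}=U(\mathfrak{sl}(m+1))\,(1\otimes V^{(m-1)})\subset\mathcal{C}_m=\mathbb{C}[x_{m,1},\dots,x_{m,m}]\otimes\mathcal{C}_{m-1}$ for $2\le m\le n$. Then $M=V^{(n-1)}$, $\widehat{M}=\mathbb{C}[x_{n,1},\dots,x_{n,n}]\otimes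 M\subset\mathcal{C}_n$, and $V_n(\lambda)=\overline{M}=V^{(n)}\subset\widehat{M}$, which is the irreducible $\mathfrak{sl}(n+1)$-module with highest weight $\lambda$. $\widehat{M}_r$ is the subspace of elements of $\widehat{M}$ homogeneous of degree $r$ in $x_{n,1},\dots,x_{n,n}$, and $(V_n(\lambda))_r=\overline{M}_r=\overline{M}\cap\widehat{M}_r$. The sets $S_n(\lambda)$. Convention: $x_{i,j}$ is a variable if $1\le j\le i$, $x_{i,i+1}=-1$, and $x_{i,j}=0$ otherwise. For $1\le j\le i\le n$ and $\Theta=(\theta_1,\dots,\theta_{i-j+1})$, $d_{i,j}(\Theta)$ is the determinant of the matrix with rows $(x_{l,\theta_1},x_{l,\theta_2},\dots,x_{l,\theta_{i-j+1}})$, $l=j,j+1,\dots,i$. Let $\mathbb{J}_{i,j}$ be the set of $\Theta=(\theta_1,\dots,\theta_{i-j+1})$ with all $\theta_r\in\{1,\dots,n\}$ and $d_{i,j}(\Theta)\ne 0$. Then $$S_n(\lambda)=\Big\{\prod_{1\le j\le i\le n}\prod_{\Theta\in\mathbb{J}_{i,j}}d_{i,j}(\Theta)^{\alpha_{i,j}(\Theta)}\ \Big|\ \alpha_{i,j}(\Theta)\in\mathbb{N};\ \sum_{i=j}^n\sum_{\Theta\in\mathbb{J}_{i,j}}\alpha_{i,j}(\Theta)\le k_{n-j+1}\text{ for }1\le j\le n\Big\},$$ and $(S_n(\lambda))_r$ is the subset of such products with $\sum_{j=1}^n\sum_{\Theta\in\mathbb{J}_{n,j}}\alpha_{n,j}(\Theta)=r$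 (the products homogeneous of degree $r$ in $x_{n,1},\dots,x_{n,n}$). *)

(* Defs.v *)
From HB Require Import structures.
From mathcomp Require Import all_boot all_order all_algebra.
From mathcomp Require Import reals complex mpoly.

Set Implicit Arguments.
Unset Strict Implicit.
Unset Printing Implicit Defensive.

Import GRing.Theory.
Local Open Scope ring_scope.

(* Indices are 1-based natural numbers throughout, as in the mathematics.    *)
(* The rings C_1, ..., C_n are all viewed inside C_n, so 1 (x) v is v, and    *)
(* an operator on C_m is given by the same differential operator on C_n.      *)
(* A highest weight is k : nat -> nat; only k 1, ..., k n are ever used.      *)

(* The pairs (i, j) with 1 <= j <= i <= n. *)
Definition tri (n : nat) : finType :=
  {ij : 'I_n.+1 * 'I_n.+1 | (0 < ij.2 <= ij.1)%N}.

(* [inord] sends an index above n to 0, so the result is [None] exactly when  *)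
(* 1 <= j <= i <= n fails.                                                    *)
Definition tri_of (n i j : nat) : option (tri n) := insub (inord i, inord j).

Definition pring (F : fieldType) (n : nat) := {mpoly F[#|tri n|]}.

Section Realization.

Variables (F : fieldType) (n : nat).

Local Notation P := (pring F n).

Definition x (i j : nat) : P :=
  if tri_of n i j is Some v then 'X_(enum_rank v)
  else if j == i.+1 then -1 else 0.

Definition dx (i j : nat) (p : P) : P :=
  if tri_of n i j is Some v then p^`M(enum_rank v) else 0.

Definition linspan (A : P -> Prop) (p : P) : Prop :=
  exists (l : nat) (a : 'I_l -> F) (g : 'I_l -> P),
    (forall t, A (g t)) /\ p = \sum_t a t *: g t.

(* The action of sl(m+1): [actE i j] is E_{i,j}, meaningful for i != j, and   *)
(* [actH i j] is E_{i,i} - E_{j,j}, for 1 <= i, j <= m+1.                     *)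
Record sl_action := SlAction {
  actE : nat -> nat -> P -> P;
  actH : nat -> nat -> P -> P }.

Variable k : nat -> nat.

Definition cm (m : nat) : F :=
  - (m.+1%:R)^-1 * \sum_(i < m) ((m - i) * k (n - m + 1 + i))%N%:R.

(* The gl(m)-action extending the action A of sl(m) in which the identity     *)
(* matrix acts as cm m: m E_{i,i} is the identity matrix plus the sum over l  *)
(* of E_{i,i} - E_{l,l}.                                                      *)
Definition gl_act (m : nat) (A : sl_action) (i j : nat) (p : P) : P :=
  if i == j then (m%:R)^-1 *: (cm m *: p + \sum_(1 <= l < m.+1) actH A i l p)
  else actE A i j p.

Definition Dm (m : nat) (p : P) : P := \sum_(1 <= s < m.+1) x m s * dx m s p.

Definition sl2_act : sl_action :=
  let h p := (x 1 1 * dx 1 1 p) *+ 2 - (k n)%:R *: p in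
  {| actE i j p :=
       if i == 1%N then x 1 1 ^+ 2 * dx 1 1 p - (k n)%:R *: (x 1 1 * p)
       else - dx 1 1 p;
     actH i j p :=
       if i == j then 0 else if i == 1%N then h p else - h p |}.

(* From sl(m) on C_{m-1} to sl(m+1) on C_m; for actH the cases involving m+1  *)
(* reduce to E_{m,m} - E_{m+1,m+1} by                                         *)
(* E_{i,i} - E_{m+1,m+1} = (E_{i,i} - E_{m,m}) + (E_{m,m} - E_{m+1,m+1}).     *)
Definition sl_step (m : nat) (A : sl_action) : sl_action :=
  let inner i j p := x m i * dx m i p - x m j * dx m j p + actH A i j p in
  let last p := Dm m p + x m m * dx m m p + cm m *: p + gl_act m A m m p in
  {| actE i j p :=
       if i == m.+1 then - dx m j p
       else if j == m.+1 then
         x m i * Dm m p + cm m *: (x m i * p)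
         + \sum_(1 <= r < m.+1) x m r * gl_act m A i r p
       else x m i * dx m j p + actE A i j p;
     actH i j p :=
       if i == j then 0
       else if j == m.+1 then inner i m p + last p
       else if i == m.+1 then - (inner j m p + last p)
       else inner i j p |}.

(* The action of sl(m+1) on C_m, for m >= 1; the value at m = 0 is unused. *)
Fixpoint sl_act (m : nat) : sl_action :=
  match m with
  | 0 => {| actE := fun _ _ _ => 0; actH := fun _ _ _ => 0 |}
  | 1 => sl2_act
  | m'.+1 => sl_step m (sl_act m')
  end.

(* A spanning set of sl(m+1), acting on C_m. *)
Inductive sl_gen (m : nat) : (P -> P) -> Prop :=
| sl_genE i j of (1 <= i <= m.+1)%N & (1 <= j <= m.+1)%N & i != j :
    sl_gen m (actE (sl_act m) i j)
| sl_genH i j of (1 <= i <= m.+1)%N & (1 <= j <= m.+1)%N :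
    sl_gen m (actH (sl_act m) i j).

(* The elements g_1 (g_2 (... (g_s w))) with w in W and each g_t in G. *)
Inductive words (G : (P -> P) -> Prop) (W : P -> Prop) : P -> Prop :=
| words0 w of W w : words G W w
| wordsS g p of G g & words G W p : words G W (g p).

(* U(sl(m+1)) W *)
Definition Usl (m : nat) (W : P -> Prop) : P -> Prop :=
  linspan (words (sl_gen m) W).

(* V^(m), for m >= 1; the value at m = 0 is unused. *)
Fixpoint Vm (m : nat) : P -> Prop :=
  match m with
  | 0 => fun p => p = 0
  | 1 => linspan (fun p => exists2 i : nat, (i <= k n)%N & p = x 1 1 ^+ i)
  | m'.+1 => Usl m (Vm m')
  end.

Definition Mbar : P -> Prop := Vm n.

(* q lies in C[x_{n,1}, ..., x_{n,n}]. *)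
Definition last_row_poly (q : P) : Prop :=
  forall u, u \in msupp q ->
  forall v : tri n, (val v).1 != n :> nat -> u (enum_rank v) = 0%N.

(* C[x_{n,1}, ..., x_{n,n}] (x) M inside C_n, where M = V^(n-1). *)
Definition Mhat : P -> Prop :=
  linspan (fun p => exists q w, [/\ last_row_poly q, Vm n.-1 w & p = q * w]).

Definition last_row_homog (r : nat) (p : P) : Prop :=
  forall u, u \in msupp p ->
  (\sum_(v : tri n | (val v).1 == n :> nat) u (enum_rank v))%N = r.

Definition Mhat_homog (r : nat) (p : P) : Prop :=
  Mhat p /\ last_row_homog r p.

Definition Mbar_homog (r : nat) (p : P) : Prop := Mbar p /\ Mhat_homog r p.

(* The candidate tuples Theta for (i, j), of length i - j + 1; the entry      *)
(* theta_{b+1} in {1, ..., n} is (th b).+1.                                   *)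
Definition theta (i j : nat) : finType := {ffun 'I_(i - j).+1 -> 'I_n}.

Definition d (i j : nat) (th : theta i j) : P :=
  \det (\matrix_(a < (i - j).+1, b < (i - j).+1) x (j + a) (th b).+1).

Definition J (i j : nat) : pred (theta i j) := fun th => d th != 0.

Definition exponents := forall i j : nat, theta i j -> nat.

Definition admissible (al : exponents) : Prop :=
  forall j, (1 <= j <= n)%N ->
  (\sum_(j <= i < n.+1) \sum_(th : theta i j | J th) al i j th
     <= k (n - j + 1))%N.

Definition ddprod (al : exponents) : P :=
  \prod_(1 <= i < n.+1) \prod_(1 <= j < i.+1) \prod_(th : theta i j | J th)
    d th ^+ al i j th.

Definition last_row_deg (al : exponents) : nat :=
  (\sum_(1 <= j < n.+1) \sum_(th : theta n j | J th) al n j th)%N.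

Definition Sset : P -> Prop :=
  fun p => exists2 al, admissible al & p = ddprod al.

Definition Sset_homog (r : nat) : P -> Prop :=
  fun p => exists al, [/\ admissible al, last_row_deg al = r & p = ddprod al].

End Realization.

(* Main.v *)
Require Import Defs.
From HB Require Import structures.
From mathcomp Require Import all_boot all_order all_algebra.
From mathcomp Require Import reals complex mpoly perm zify ring.

(* Attach to a family c of columns the product of the minors of the triangular  *)
(* array (x_{l,c}) on the rows j, ..., m, with k_{n-j+1} factors for each j.    *)
(* Expanding along the entries x_{i,i+1} = -1 shows that these products span    *)
(* the same space as S_n(lambda). A root vector E_{a,b} acts on such a product  *)
(* by replacing, in turn, each column index b by a, so the span is stable.      *)
(*                                                                              *)
(* Conversely let P_w run over all these products and let F(x, z) be the sum of *)
(* the P_w(x) P_w(z). Replacing b by a is adjoint to replacing a by b, so       *)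
(* E_{a,b} acting in x agrees on F with E_{b,a} acting in z; as E_{l+1,i} acts  *)
(* like - d/dz_{l,i} on polynomials in the rows up to l, every coefficient of F *)
(* in z is obtained from a constant by applying root vectors. Finally the P_w   *)
(* have real coefficients, and A and A^T A have the same row space for a real   *)
(* matrix A, so that the coefficients of F in z span all the P_w.               *)

Set Implicit Arguments.
Unset Strict Implicit.
Unset Printing Implicit Defensive.

Import GRing.Theory Num.Theory.
Local Open Scope ring_scope.

(** * Linear spans and the variables *)

(** The middle term of the proof is [mprod_span k m]: the span of the products of minors on the rows
    [j..m] of the array, with [k (n - j + 1)] factors for each first row [j] and arbitrary columns
    in [1..m+1]. This is the realization of a highest weight module by flag minors, restricted to
    the matrices with entries -1 just above the diagonal and 0 beyond. [Vm_Qs] identifies this span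
    with V^(m), and [Sset_Qs] identifies it, at m = n, with the span of S_n(lambda).

    In [Vm_Qs], the formula [natE_mprod] gives stability under sl(m+1), and [Qs_up] shows that the
    span grows with m; hence V^(m) lies in the span. The other inclusion is [Qs_min]: a subspace
    that contains 1 and is stable under the root vectors contains every product. Here [natE_kerc] is
    the adjointness of the kernel, [kerc0] and [kerc_raise] build all its coefficients from a
    constant, and [gram_submx] recovers the products from these coefficients.

    For the graded statement, the column indices of the d_{i,j}(Theta) stop at n, so row n
    contributes only genuine variables and each product is homogeneous in the last row
    ([ddprod_dhomog]). Projection to degree r then keeps or kills each product. Membership in Mhat
    comes from expanding minors along row n ([Mgen_minor]).

    Products are transferred from one family to another factor by factor, through the notion
    [graded]. *)

Section Span.
Variables (F : fieldType) (n : nat).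
Local Notation P := (pring F n).
Implicit Types (A B C : P -> Prop) (p q : P).

Definition subspace C := [/\ C 0, forall p q, C p -> C q -> C (p + q)
  & forall (a : F) p, C p -> C (a *: p)].

Lemma subspace_sum C I (r : seq I) (Q : pred I) (f : I -> P) : subspace C ->
  (forall i, Q i -> C (f i)) -> C (\sum_(i <- r | Q i) f i).
Proof. by case=> C0 CD _ Cf; apply: big_ind. Qed.

Lemma linspan_subspace A : subspace (linspan A).
Proof.
split.
- exists 0%N, (fun=> 0), (fun=> 0); split; first by case.
  by rewrite big_ord0.
- move=> p q [l1 [a1 [g1 [Ag1 ->]]]] [l2 [a2 [g2 [Ag2 ->]]]].
  exists (l1 + l2)%N, (fun t => match split t with inl i => a1 i | inr i => a2 i end),
    (fun t => match split t with inl i => g1 i | inr i => g2 i end).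
  split; first by move=> t; case: (split t).
  rewrite big_split_ord /=; congr (_ + _); apply: eq_bigr => t _.
    by case: split_ordP => j /eqP; rewrite ?eq_lshift ?eq_lrshift // => /eqP->.
  by case: split_ordP => j /eqP; rewrite ?eq_rshift ?eq_rlshift // => /eqP->.
- move=> c p [l [a [g [Ag ->]]]]; exists l, (fun t => c * a t), g; split=> //.
  by rewrite scaler_sumr; apply: eq_bigr => t _; rewrite scalerA.
Qed.

Lemma mem_linspan A p : A p -> linspan A p.
Proof.
by move=> Ap; exists 1%N, (fun=> 1), (fun=> p); rewrite big_ord1 scale1r.
Qed.

Lemma linspan_min A C p :
  subspace C -> (forall q, A q -> C q) -> linspan A p -> C p.
Proof.
move=> sC AC [l [a [g [Ag ->]]]]; apply: subspace_sum => // t _.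
by case: sC => _ _; apply; apply: AC.
Qed.

Lemma linspan_sub A B p :
  (forall q, A q -> linspan B q) -> linspan A p -> linspan B p.
Proof. by apply: linspan_min; apply: linspan_subspace. Qed.

Lemma linspanM A B C p q :
  (forall a b, A a -> B b -> linspan C (a * b)) ->
  linspan A p -> linspan B q -> linspan C (p * q).
Proof.
move=> ABC Ap Bq; move: Ap; have [C0 CD CZ] := linspan_subspace C.
apply: (@linspan_min A (fun p => linspan C (p * q))).
  split=> [|u v Cu Cv|a u Cu]; first by rewrite mul0r.
    by rewrite mulrDl; apply: CD.
  by rewrite -scalerAl; apply: CZ.
move=> a Aa; move: Bq; apply: (@linspan_min B (fun q => linspan C (a * q))).
  split=> [|u v Cu Cv|c u Cu]; first by rewrite mulr0.
    by rewrite mulrDr; apply: CD.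
  by rewrite -scalerAr; apply: CZ.
by move=> b; apply: ABC.
Qed.

Lemma linspan0 A : linspan A 0. Proof. by case: (linspan_subspace A). Qed.
Lemma linspanD A p q : linspan A p -> linspan A q -> linspan A (p + q).
Proof. by case: (linspan_subspace A) => _ + _; apply. Qed.
Lemma linspanZ A c p : linspan A p -> linspan A (c *: p).
Proof. by case: (linspan_subspace A) => _ _; apply. Qed.
Lemma linspanN A p : linspan A p -> linspan A (- p).
Proof. by rewrite -scaleN1r; apply: linspanZ. Qed.
Lemma linspan_sum A I (r : seq I) (Q : pred I) (f : I -> P) :
  (forall i, Q i -> linspan A (f i)) -> linspan A (\sum_(i <- r | Q i) f i).
Proof. by apply: subspace_sum; apply: linspan_subspace. Qed.

End Span.

Section Entries.
Variables (F : fieldType) (n : nat).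
Local Notation P := (pring F n).
Local Notation x := (@x F n).
Local Notation dx := (@dx F n).
Implicit Types (p q : P) (i j l c : nat).

Lemma tri_ofP i j : if tri_of n i j is Some v then
  [/\ (0 < j <= i)%N, (i <= n)%N & val v = (inord i, inord j)] else ~~ ((0 < j <= i)%N && (i <= n)%N).
Proof.
have inord0 t : (n < t)%N -> (inord t : 'I_n.+1) = 0%N :> nat.
  by move=> nt; rewrite /inord /insubd insubF ?ltnS ?(ltn_geF nt).
rewrite /tri_of; case: insubP => [v /= + ->|].
  case: (leqP i n) => [hi|/inord0->]; last by lia.
  by case: (leqP j n) => [hj|/inord0->]; [rewrite !inordK | lia].
by apply: contra => /andP[h h']; rewrite /= !inordK //; lia.
Qed.

Lemma tri_of_some i j : (0 < j <= i)%N -> (i <= n)%N -> {v : tri n |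
  tri_of n i j = Some v & [/\ val (val v).1 = i & val (val v).2 = j]}.
Proof.
move=> h hi; have := tri_ofP i j; case: tri_of => [v|]; last by lia.
case=> _ _ e; exists v => //; rewrite e /= !inordK //; lia.
Qed.

Lemma tri_of_val (v : tri n) : tri_of n (val v).1 (val v).2 = Some v.
Proof.
have h := valP v; have := tri_ofP (val v).1 (val v).2.
have := ltn_ord (val v).1.
case: tri_of => [w _|]; last by rewrite /= in h *; lia.
case=> _ _ e; congr Some; apply: val_inj; rewrite e !inord_val.
by case: (val v).
Qed.

Lemma xE i : x i i.+1 = -1.
Proof.
rewrite /x; have := tri_ofP i i.+1; case: tri_of => [v|]; first by case; lia.
by rewrite eqxx.
Qed.

Lemma x_gt i j : (i.+1 < j)%N -> x i j = 0.
Proof.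
rewrite /x => h; have := tri_ofP i j; case: tri_of => [v|]; first by case; lia.
by rewrite gtn_eqF.
Qed.

Lemma dxD i j p q : dx i j (p + q) = dx i j p + dx i j q.
Proof. by rewrite /dx; case: tri_of => [v|]; rewrite ?mderivD ?addr0. Qed.
Lemma dxZ i j a p : dx i j (a *: p) = a *: dx i j p.
Proof. by rewrite /dx; case: tri_of => [v|]; rewrite ?mderivZ ?scaler0. Qed.
Lemma dxM i j p q : dx i j (p * q) = dx i j p * q + p * dx i j q.
Proof.
by rewrite /dx; case: tri_of => [v|]; rewrite ?mderivM // mul0r mulr0 addr0.
Qed.

Lemma dx_x i j l c : (0 < j <= i)%N -> (i <= n)%N ->
  dx i j (x l c) = ((l == i) && (c == j))%:R.
Proof.
move=> hj hi; rewrite /dx; have [v -> [v1 v2]] := tri_of_some hj hi.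
rewrite /x; have := tri_ofP l c; case: tri_of => [w [h h' e]|].
  rewrite mderivX mnm1E (inj_eq enum_rank_inj).
  have -> : (w == v) = (l == i) && (c == j).
    have ev : val v = (inord i, inord j).
      by rewrite -v1 -v2 !inord_val; case: (val v).
    by rewrite -(inj_eq val_inj) e ev xpair_eqE -!val_eqE /= !inordK //; lia.
  case: (_ && _) / andP => [[/eqP li /eqP cj]|]; last by rewrite scale0r.
  have <- : w = v.
    apply: val_inj; rewrite e li cj -v1 -v2 !inord_val.
    by case: (val v).
  rewrite scale1r; suff -> : (U_(enum_rank w) - U_(enum_rank w))%MM = 0%MM.
    by rewrite mpolyX0.
  by apply/mnmP => t; rewrite mnmBE mnm0E subnn.
move=> h; have -> : (l == i) && (c == j) = false by lia.
by case: eqP; rewrite ?mderivN ?mderiv0 // -mpolyC1 mderivC oppr0.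
Qed.

End Entries.

(** * The natural action of gl(m+1) *)

Section NaturalAction.
Variables (F : numFieldType) (n : nat) (k : nat -> nat).
Local Notation P := (pring F n).
Local Notation x := (@x F n).
Local Notation dx := (@dx F n).
Local Notation Dm := (@Dm F n).
Implicit Types (p q : P) (i j l c m : nat).

(* The number of minors with first row j. *)
Definition mult j := k (n - j + 1).
Definition mult_sum m := (\sum_(1 <= j < m.+1) mult j)%N.
Definition kdeg m := (\sum_(1 <= j < m.+1) mult j * (m.+1 - j))%N.

(* E_{i,j} for gl(m+1), normalised so that the identity matrix acts by kdeg m,  *)
(* the number of rows of all the minors, and not by cm: this is the action for  *)
(* which E_{i,j} replaces column indices j by i.                                *)
Fixpoint natE m i j p : P :=
  if m is m'.+1 then
    if i == m.+1 then
      if j == m.+1 then (mult_sum m)%:R *: p - Dm m p else - dx m j p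
    else if j == m.+1 then
      x m i * Dm m p + \sum_(1 <= r < m.+1) x m r * natE m' i r p
      - (mult_sum m)%:R *: (x m i * p)
    else x m i * dx m j p + natE m' i j p
  else 0.

Lemma natES m i j p : natE m.+1 i j p =
  if i == m.+2 then
    if j == m.+2 then (mult_sum m.+1)%:R *: p - Dm m.+1 p else - dx m.+1 j p
  else if j == m.+2 then
    x m.+1 i * Dm m.+1 p + \sum_(1 <= r < m.+2) x m.+1 r * natE m i r p
    - (mult_sum m.+1)%:R *: (x m.+1 i * p)
  else x m.+1 i * dx m.+1 j p + natE m i j p.
Proof. by []. Qed.
Arguments natE : simpl never.

Lemma mult_sumS m : mult_sum m.+1 = (mult_sum m + mult m.+1)%N.
Proof. by rewrite /mult_sum big_nat_recr. Qed.

Lemma kdegS m : kdeg m.+1 = (kdeg m + mult_sum m.+1)%N.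
Proof.
rewrite mult_sumS {1}/kdeg big_nat_recr //= addnA -big_split /=.
rewrite subSn // subnn muln1; congr (_ + _)%N.
by apply: eq_big_nat => j jm; rewrite [in LHS]subSn ?mulnS 1?addnC //; lia.
Qed.

(** Put [j = m - i] in the sum defining [cm]: it becomes the sum of [j * mult j], while [kdeg m.-1]
    is the sum of [mult j * (m - j)]. Together they give [m * mult_sum m]. *)
Lemma cmE m : (0 < m <= n)%N ->
  m.+1%:R * @cm F n k m = (kdeg m.-1)%:R - m%:R * (mult_sum m)%:R.
Proof.
move=> /andP[m0 mn]; have m10 : m.+1%:R != 0 :> F by rewrite pnatr_eq0.
rewrite /cm mulrA mulrN mulfV // mulN1r -natr_sum.
apply/eqP; rewrite -subr_eq0 -opprD oppr_eq0 addrA subr_eq0 -natrD -natrM eqr_nat.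
apply/eqP; have -> : (\sum_(i < m) (m - i) * k (n - m + 1 + i) =
    \sum_(1 <= j < m.+1) j * mult j)%N.
  rewrite big_add1 /= big_mkord (reindex_inj rev_ord_inj) /=.
  apply: eq_bigr => i _; have im := ltn_ord i.
  by congr (_ * k _)%N; lia.
have -> : kdeg m.-1 = (\sum_(1 <= j < m.+1) mult j * (m - j))%N.
  by rewrite /kdeg prednK // [RHS]big_nat_recr //= subnn muln0 addn0.
rewrite -big_split /mult_sum big_distrr /=; apply: eq_big_nat => j jm.
by rewrite mulnC -mulnDr mulnC subnKC //; lia.
Qed.

Lemma natE_sum m p : \sum_(1 <= l < m.+2) natE m l l p = (kdeg m)%:R *: p.
Proof.
elim: m p => [|m IH] p; first by rewrite big_nat1 /kdeg big_geq // scale0r.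
rewrite big_nat_recr //= [natE _ m.+2 _ _]natES eqxx kdegS natrD scalerDl -IH.
have -> : \sum_(1 <= l < m.+2) natE m.+1 l l p =
    \sum_(1 <= l < m.+2) (x m.+1 l * dx m.+1 l p + natE m l l p).
  apply: eq_big_nat => l lm; rewrite natES.
  by have -> : (l == m.+2) = false by lia.
by rewrite big_split /= -/(Dm m.+1 p) [Dm m.+1 p + _]addrC addrACA subrr addr0.
Qed.

Lemma natE_lin m i j : {morph natE m i j : p q / p + q} *
  (forall a, {morph natE m i j : p / a *: p}).
Proof.
have DmD t : {morph Dm t : p q / p + q}.
  move=> p q; rewrite /Dm -big_split; apply: eq_bigr => l _.
  by rewrite dxD mulrDr.
have DmZ t a : {morph Dm t : p / a *: p}.
  move=> p; rewrite /Dm scaler_sumr; apply: eq_bigr => l _.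
  by rewrite dxZ scalerAr.
elim: m i j => [|m IH] i j.
  by split=> [p q|a p]; rewrite /natE ?addr0 ?scaler0.
split=> [p q|a p]; rewrite !natES; do 2 case: ifP => _.
- by rewrite DmD scalerDr opprD addrACA.
- by rewrite dxD opprD.
- under eq_bigr do rewrite (IH _ _) mulrDr.
  rewrite big_split /= DmD !mulrDr scalerDr opprD; ring.
- by rewrite dxD IH mulrDr addrACA.
- by rewrite DmZ scalerBr !scalerA mulrC.
- by rewrite dxZ scalerN.
- under eq_bigr do rewrite (IH _ _) -scalerAr.
  by rewrite -scaler_sumr DmZ -!scalerAr scalerBr scalerDr !scalerA [a * _]mulrC.
- by rewrite dxZ IH -scalerAr scalerDr.
Qed.

(** The identity matrix of gl(m) acts by [cm m] in the construction and by [kdeg m.-1] in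
    [natE m.-1]; this is the difference, shared equally among the m diagonal units. *)
Definition gl_shift m : F := m%:R^-1 * (cm F n k m - (kdeg m.-1)%:R).

Lemma gl_shiftE m : (0 < m <= n)%N -> cm F n k m + gl_shift m = - (mult_sum m)%:R.
Proof.
move=> mn; have m0 : m%:R != 0 :> F by rewrite pnatr_eq0; lia.
have h : m%:R * cm F n k m + cm F n k m = (kdeg m.-1)%:R - m%:R * (mult_sum m)%:R.
  by rewrite -cmE // -addn1 natrD mulrDl mul1r.
apply: (mulfI m0); rewrite /gl_shift mulrDr mulVKf // addrA h; ring.
Qed.

(** Adding a multiple of the trace to a gl-action changes neither the off-diagonal units nor the
    differences of diagonal ones. The shift enters only through [gl_act], where [gl_shiftE] turns
    [cm] into [- mult_sum]. *)
Lemma sl_act_natE m : (m <= n)%N ->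
  (forall i j p, (1 <= i <= m.+1)%N -> (1 <= j <= m.+1)%N -> i != j ->
     actE (sl_act F n k m) i j p = natE m i j p) /\
  (forall i j p, (1 <= i <= m.+1)%N -> (1 <= j <= m.+1)%N ->
     actH (sl_act F n k m) i j p = natE m i i p - natE m j j p).
Proof.
elim: m => [_|m IH mn].
  split=> [i j p|i j p] *; first by have : i = j by lia.
  by rewrite subrr.
have [IHE IHH] := IH (ltnW mn).
have glE i j p : (1 <= i <= m.+1)%N -> (1 <= j <= m.+1)%N ->
    gl_act k m.+1 (sl_act F n k m) i j p = natE m i j p + (i == j)%:R * gl_shift m.+1 *: p.
  move=> im jm; rewrite /gl_act; case: eqP => [<-|/eqP ij]; last first.
    by rewrite IHE // mul0r scale0r addr0.
  have -> : \sum_(1 <= l < m.+2) actH (sl_act F n k m) i l p = natE m i i p *+ m.+1 - (kdeg m)%:R *: p.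
    rewrite -natE_sum.
    have -> : natE m i i p *+ m.+1 = \sum_(1 <= l < m.+2) natE m i i p.
      by rewrite big_const_nat subn1 iter_addr_0.
    by rewrite -sumrB; apply: eq_big_nat => l lm; apply: IHH.
  have m0 : m.+1%:R != 0 :> F by rewrite pnatr_eq0.
  rewrite mul1r /gl_shift -scaler_nat addrCA -scalerBl scalerDr !scalerA.
  by rewrite mulVf // scale1r.
(* Rank one is checked by hand, since [sl_act] is there the explicit [sl2_act] and not an instance
   of [sl_step]. *)
case: m IH IHE IHH glE mn => [|m] IH IHE IHH glE mn.
  have k1 : mult_sum 1 = k n by rewrite /mult_sum big_nat1 /mult subnK.
  have D1 p : Dm 1 p = x 1 1 * dx 1 1 p by rewrite /Dm big_nat1.
  have two i : (1 <= i <= 2)%N -> i = 1%N \/ i = 2%N by lia.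
  have e12 p : actE (sl_act F n k 1) 1 2 p = natE 1 1 2 p.
    by rewrite /= natES /= big_nat1 D1 k1 mulr0 addr0 mulrA.
  have h12 p : actH (sl_act F n k 1) 1 2 p = natE 1 1 1 p - natE 1 2 2 p.
    by rewrite /= !natES /= D1 k1 /natE addr0 mulr2n; ring.
  split=> i j p /two[]-> /two[]-> //.
  - by rewrite subrr.
  - have -> : actH (sl_act F n k 1) 2 1 p = - actH (sl_act F n k 1) 1 2 p by [].
    by rewrite h12 opprB.
  - by rewrite subrr.
have last p : Dm m.+2 p + x m.+2 m.+2 * dx m.+2 m.+2 p + cm F n k m.+2 *: p
      + gl_act k m.+2 (sl_act F n k m.+1) m.+2 m.+2 p
    = natE m.+2 m.+2 m.+2 p - natE m.+2 m.+3 m.+3 p.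
  rewrite glE ?leqnn // eqxx mul1r.
  rewrite !(natES m.+1) eqxx.
  have -> : m.+2 == m.+3 = false by lia.
  have e := @gl_shiftE m.+2 mn.
  have -> : gl_shift m.+2 = - (mult_sum m.+2)%:R - cm F n k m.+2 by rewrite -e; ring.
  by rewrite scalerBl scaleNr; ring.
split=> i j p im jm.
  move=> ij; rewrite [LHS]/= natES.
  case: eqP => [ei|/eqP ei].
    by have -> : j == m.+3 = false by lia.
  case: eqP => [ej|/eqP ej]; last by rewrite IHE //; lia.
  have -> : \sum_(1 <= r < m.+3) x m.+2 r * gl_act k m.+2 (sl_act F n k m.+1) i r p
    = \sum_(1 <= r < m.+3) (x m.+2 r * natE m.+1 i r p
        + x m.+2 r * ((i == r)%:R * gl_shift m.+2 *: p)).
    by apply: eq_big_nat => r rm; rewrite glE ?mulrDr //; lia.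
  rewrite big_split /= -!addrA; congr (_ + _); rewrite addrCA; congr (_ + _).
  have ir : i \in index_iota 1 m.+3 by rewrite mem_index_iota; lia.
  rewrite (bigD1_seq i ir (iota_uniq _ _)) /=.
  rewrite big1_seq => [|r /andP[/negPf ri _]]; last first.
    by rewrite eq_sym ri mul0r scale0r mulr0.
  rewrite eqxx mul1r addr0 -scalerAr -scalerDl gl_shiftE //.
  by rewrite scaleNr.
rewrite [LHS]/=; case: eqP => [->|/eqP ij]; first by rewrite subrr.
have inner i' j' : (1 <= i' <= m.+2)%N -> (1 <= j' <= m.+2)%N ->
    x m.+2 i' * dx m.+2 i' p - x m.+2 j' * dx m.+2 j' p + actH (sl_act F n k m.+1) i' j' p
    = natE m.+2 i' i' p - natE m.+2 j' j' p.
  move=> im' jm'; rewrite IHH // !(natES m.+1).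
  have -> : i' == m.+3 = false by lia.
  have -> : j' == m.+3 = false by lia.
  by rewrite opprD addrACA.
case: eqP => [ej|/eqP ej].
  by rewrite ej last inner ?addrA ?subrK //; lia.
case: eqP => [ei|/eqP ei]; last by rewrite inner //; lia.
by rewrite ei last inner ?addrA ?subrK ?opprB //; lia.
Qed.

End NaturalAction.

(** * Root vectors as derivations with a scalar correction *)

Section Derivations.
Variables (F : fieldType) (n : nat).
Local Notation P := (pring F n).
Local Notation x := (@x F n).
Local Notation dx := (@dx F n).
Local Notation Dm := (@Dm F n).
Implicit Types (p q : P) (D : P -> P) (i j l c m : nat).

Record derivation D : Prop := Derivation {
  derD : forall p q, D (p + q) = D p + D q;
  derZ : forall (a : F) p, D (a *: p) = a *: D p;
  derM : forall p q, D (p * q) = D p * q + p * D q }.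

Lemma derivation_dx i j : derivation (dx i j).
Proof. split; [exact: dxD | exact: dxZ | exact: dxM]. Qed.

Lemma derivation_add D D' :
  derivation D -> derivation D' -> derivation (fun p => D p + D' p).
Proof.
move=> dD dD'; split=> [p q|a p|p q].
- by rewrite (derD dD) (derD dD') addrACA.
- by rewrite (derZ dD) (derZ dD') scalerDr.
- by rewrite (derM dD) (derM dD'); ring.
Qed.

Lemma derivation_mul q D : derivation D -> derivation (fun p => q * D p).
Proof.
move=> dD; split=> [p q'|a p|p q'].
- by rewrite (derD dD) mulrDr.
- by rewrite (derZ dD) scalerAr.
- by rewrite (derM dD); ring.
Qed.

Lemma derivation_ext D D' : D =1 D' -> derivation D -> derivation D'.
Proof.
move=> e dD; split=> *; rewrite -!e; [exact: derD|exact: derZ|exact: derM].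
Qed.

Lemma derivation_opp D : derivation D -> derivation (fun p => - D p).
Proof.
move/(derivation_mul (-1)); apply: derivation_ext => p; exact: mulN1r.
Qed.

Lemma der0 D : derivation D -> D 0 = 0.
Proof. by move=> dD; have := derZ dD 0 0; rewrite !scale0r. Qed.

Lemma derivation_sum (I : Type) (r : seq I) (D : I -> P -> P) :
  (forall t, derivation (D t)) -> derivation (fun p => \sum_(i <- r) D i p).
Proof.
move=> dD; elim: r => [|i r IH].
  by split=> *; rewrite !big_nil ?addr0 ?scaler0 ?mul0r ?mulr0 ?addr0.
apply: derivation_ext (derivation_add (dD i) IH) => p.
by rewrite big_cons.
Qed.

Lemma derivation_Dm m : derivation (Dm m).
Proof.
by apply: derivation_sum => i; apply/derivation_mul/derivation_dx.
Qed.

Lemma derN D p : derivation D -> D (- p) = - D p.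
Proof. by move=> dD; rewrite -scaleN1r (derZ dD) scaleN1r. Qed.

Lemma der1 D : derivation D -> D 1 = 0.
Proof.
by move=> dD; have := derM dD 1 1; rewrite !mulr1 mul1r -{1}[D 1]add0r => /addIr.
Qed.

Lemma der_sum D (I : Type) (r : seq I) (Q : pred I) (f : I -> P) : derivation D ->
  D (\sum_(i <- r | Q i) f i) = \sum_(i <- r | Q i) D (f i).
Proof.
by move=> dD; apply: (big_morph D); [exact: derD | exact: der0].
Qed.

Lemma der_prod D (I : eqType) (r : seq I) (f : I -> P) : derivation D -> uniq r ->
  D (\prod_(i <- r) f i) =
  \sum_(i <- r) D (f i) * \prod_(i' <- r | i' != i) f i'.
Proof.
move=> dD; elim: r => [|i r IH]; first by rewrite !big_nil der1.
rewrite cons_uniq => /andP[ir ur]; rewrite !big_cons (derM dD) IH // eqxx.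
congr (_ * _ + _).
  rewrite big_seq [RHS]big_seq_cond; apply: eq_bigl => i' .
  by case i'r: (i' \in r) => //=; apply/esym; apply: contraNneq ir => <-.
rewrite big_distrr big_seq [RHS]big_seq; apply: eq_bigr => i' i'r /=.
have ii' : i != i' by apply: contraNneq ir => ->.
by rewrite big_cons ii' mulrCA.
Qed.

(** Jacobi's formula: apply the product rule to each permutation term, then regroup by the value
    [j = s i]. *)
Lemma det_der D m (A : 'M[P]_m) : derivation D ->
  D (\det A) = \sum_i \sum_j D (A i j) * cofactor A i j.
Proof.
move=> dD; rewrite /determinant (der_sum _ _ _ dD).
transitivity (\sum_(s : 'S_m) \sum_i (-1) ^+ s *
    (D (A i (s i)) * \prod_(i' | i != i') A i' (s i'))).
  apply: eq_bigr => s _; rewrite -big_distrr /=.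
  have -> q : D ((-1) ^+ s * q) = (-1) ^+ s * D q.
    by case: (odd_perm s); rewrite ?expr0 ?expr1 ?mul1r // !mulN1r derN.
  congr (_ * _); rewrite der_prod ?index_enum_uniq //.
  by apply: eq_bigr => i _; under eq_bigl do rewrite eq_sym.
rewrite exchange_big; apply: eq_bigr => i _ /=.
under [RHS]eq_bigr do rewrite expand_cofactor big_distrr /=.
rewrite (partition_big (fun s : 'S_m => s i) xpredT) //=.
apply: eq_bigr => j _; apply: eq_bigr => s /eqP <-.
by rewrite mulrCA.
Qed.

Lemma Dm_x m l c : (0 < m <= n)%N ->
  Dm m (x l c) = ((l == m) && (0 < c <= m)%N)%:R * x m c.
Proof.
move=> mn; rewrite /Dm.
transitivity (\sum_(1 <= s < m.+1) x m s * ((l == m) && (c == s))%:R).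
  by apply: eq_big_nat => s sm; rewrite dx_x //; lia.
have [_|_] /= := eqVneq l m; last by rewrite mul0r big1 // => s _; rewrite mulr0.
have [cm|cm] := boolP (0 < c <= m)%N.
  have ir : c \in index_iota 1 m.+1 by rewrite mem_index_iota; lia.
  rewrite (bigD1_seq c ir (iota_uniq _ _)) /= eqxx mulr1 mul1r big1 ?addr0 //.
  by move=> s /negPf; rewrite eq_sym => ->; rewrite mulr0.
rewrite mul0r big_nat big1 // => s sm.
have -> : (c == s) = false by lia.
by rewrite mulr0.
Qed.

End Derivations.

Section NatOp.
Variables (F : numFieldType) (n : nat) (k : nat -> nat).
Local Notation P := (pring F n).
Local Notation x := (@x F n).
Local Notation dx := (@dx F n).
Local Notation Dm := (@Dm F n).
Local Notation natE := (@natE F n k).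
Local Notation kk := (mult n k).
Local Notation ksum := (mult_sum n k).
Implicit Types (p q : P) (D : P -> P) (i j l c m : nat).

Let b1 : (true%:R : P) = 1 := erefl.
Let b0 : (false%:R : P) = 0 := erefl.

(** The factor by which the infinitesimal row operation [N], upper triangular, multiplies a product
    with [kk t] minors on the rows [t..m] for each t. *)
Definition wtrace m (N : nat -> nat -> P) : P :=
  \sum_(1 <= t < m.+1) (kk t)%:R * \sum_(t <= l < m.+1) N l l.

Lemma wtraceS m N : wtrace m.+1 N = wtrace m N + (ksum m.+1)%:R * N m.+1 m.+1.
Proof.
rewrite /wtrace mult_sumS natrD mulrDl addrA big_nat_recr //=; congr (_ + _); last first.
  by rewrite big_nat_recr //= big_geq // add0r.
rewrite /mult_sum natr_sum mulr_suml -big_split; apply: eq_big_nat => t tm.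
by rewrite /= -mulrDr big_nat_recr //; lia.
Qed.

Lemma eq_wtrace m N N' : (forall l, (1 <= l <= m)%N -> N l l = N' l l) ->
  wtrace m N = wtrace m N'.
Proof.
move=> e; apply: eq_big_nat => t tm; congr (_ * _); apply: eq_big_nat => l lm.
by apply: e; lia.
Qed.

Lemma wtrace0 m : wtrace m (fun _ _ => 0) = 0.
Proof. by rewrite /wtrace big1 // => t _; rewrite big1 // mulr0. Qed.

(* Right translation by E_{a,b} changes the constant entries -1 and 0 of the    *)
(* array; the upper triangular row operation N restores them, and multiplies    *)
(* the minor on the rows t, ..., m by the corresponding partial trace of N.     *)
Definition lifts m (T : nat -> nat -> P) (op : P -> P) : Prop :=
  exists D (N : nat -> nat -> P),
  [/\ derivation D, forall l l', (l' < l)%N -> N l l' = 0,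
      forall l c, (m < l)%N -> D (x l c) = 0,
      forall l c, (1 <= l <= m)%N -> (1 <= c <= m.+1)%N ->
        D (x l c) = T l c + \sum_(1 <= l' < m.+1) N l l' * x l' c
    & forall p, op p = D p - wtrace m N * p].

Definition Esub i j l c : P := (c == j)%:R * x l i.

(** The property is linear over polynomials, because derivations and row operations may be
    multiplied by them. This handles the sum of the [x m r * natE _ i r] inside E_{i,m+1}. *)
Lemma lifts_sum m (r : seq nat) (T : nat -> nat -> nat -> P) (q : nat -> P) (op : nat -> P -> P) :
  (forall i, i \in r -> lifts m (T i) (op i)) ->
  lifts m (fun l c => \sum_(i <- r) q i * T i l c) (fun p => \sum_(i <- r) q i * op i p).
Proof.
elim: r => [_|i0 r IH H].
  exists (fun=> 0), (fun _ _ => 0); split=> // [|l c _ _|p].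
  - by split=> *; rewrite ?addr0 ?scaler0 ?mul0r ?mulr0 ?addr0.
  - by rewrite big_nil add0r big1 // => ? _; rewrite mul0r.
  - by rewrite big_nil wtrace0 mul0r subrr.
have [D1 [N1 [d1 u1 z1 a1 o1]]] := H i0 (mem_head _ _).
have [|D2 [N2 [d2 u2 z2 a2 o2]]] := IH.
  by move=> i1 i1r; apply: H; rewrite inE i1r orbT.
exists (fun p => q i0 * D1 p + D2 p), (fun l l' => q i0 * N1 l l' + N2 l l').
split=> [|l l' ll|l c ml|l c lm cm|p].
- by apply: derivation_add => //; apply: derivation_mul.
- by rewrite u1 // u2 // mulr0 addr0.
- by rewrite z1 // z2 // mulr0 addr0.
- rewrite a1 // a2 // big_cons mulrDr addrACA; congr (_ + _).
  by rewrite big_distrr -big_split; apply: eq_bigr => l' _; rewrite /= mulrDl mulrA.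
- rewrite big_cons o1 o2 mulrBr addrACA -opprD; congr (_ - _).
  have -> : wtrace m (fun l l' => q i0 * N1 l l' + N2 l l') = q i0 * wtrace m N1 + wtrace m N2.
    rewrite /wtrace big_distrr -big_split; apply: eq_bigr => t _.
    by rewrite big_split -big_distrr /= mulrDr mulrCA.
  by rewrite mulrDl mulrA.
Qed.


Lemma sum_row_gt m (N : nat -> nat -> P) l :
  \sum_(1 <= l' < m.+1) N l l' * x l' m.+2 = 0.
Proof.
by rewrite big_nat big1 // => l' lm; rewrite x_gt ?mulr0 //; lia.
Qed.

Lemma natE_lifts m i j : (m <= n)%N -> (1 <= i <= m.+1)%N -> (1 <= j <= m.+1)%N ->
  lifts m (Esub i j) (natE m i j).
Proof.
elim: m i j => [|m IH] i j mn im jm.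
  exists (fun=> 0), (fun _ _ => 0); split=> // [|l c|p].
  - by split=> *; rewrite ?addr0 ?scaler0 ?mul0r ?mulr0 ?addr0.
  - lia.
  - by rewrite wtrace0 mul0r subrr.
have mn' : (m <= n)%N by lia.
have [ei|ei] := eqVneq i m.+2; have [ej|ej] := eqVneq j m.+2.
- exists (fun p => - Dm m.+1 p),
    (fun l l' => if (l == m.+1) && (l' == m.+1) then -1 else 0).
  split=> [|l l' ll|l c ml|l c lm cm|p].
  + exact/derivation_opp/derivation_Dm.
  + by case: ifP => //; lia.
  + rewrite Dm_x //; have -> : l == m.+1 = false by lia.
    by rewrite mul0r oppr0.
  + rewrite Dm_x // /Esub ei ej big_nat_recr //= big_nat big1 => [|l' lm']; last first.
      have -> : l' == m.+1 = false by lia.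
      by rewrite andbF mul0r.
    rewrite eqxx andbT add0r; have [->|lm1] := eqVneq l m.+1; last first.
      by rewrite !mul0r oppr0 addr0 x_gt ?mulr0 //; lia.
    have [->|cm2] := eqVneq c m.+2.
      by rewrite ltnn andbF b1 b0 xE; ring.
    have -> : (0 < c <= m.+1)%N by lia.
    by rewrite b1 b0; ring.
  + rewrite natES ei ej eqxx wtraceS (@eq_wtrace _ _ (fun _ _ => 0)) ?wtrace0.
      by rewrite scaler_nat -[p *+ _]mulr_natl eqxx /=; ring.
    by move=> l lm; have -> : l == m.+1 = false by lia.
- exists (fun p => - dx m.+1 j p), (fun _ _ => 0).
  have j1 : (0 < j <= m.+1)%N by lia.
  split=> [|//|l c ml|l c lm cm|p].
  + exact/derivation_opp/derivation_dx.
  + rewrite dx_x //; have -> : l == m.+1 = false by lia.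
    by rewrite oppr0.
  + rewrite dx_x // /Esub ei big1 => [|l' _]; last by rewrite mul0r.
    have [->|lm1] := eqVneq l m.+1; first by rewrite xE ?b1; ring.
    by rewrite x_gt ?b0 /=; [ring|lia].
  + by rewrite natES ei eqxx (negPf ej) wtrace0 mul0r subr0.
- have i1 : (0 < i <= m.+1)%N by lia.
  have [|D [N [d u z a o]]] := @lifts_sum m (index_iota 1 m.+2) (fun r => Esub i r) (fun r => x m.+1 r) (fun r => natE m i r).
    by move=> r; rewrite mem_index_iota => rm; apply: IH; lia.
  (* Column m+2 is constant: -1 in row m+1 and 0 above. Since [D] kills it while [Esub] replaces it
     by column i, the last column of [N] has to be column i. *)
  exists (fun p => x m.+1 i * Dm m.+1 p + D p),
    (fun l l' => if (l <= m)%N && (l' <= m)%N then N l l' else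
       if l' == m.+1 then if (l <= m.+1)%N then x l i else 0 else 0).
  split=> [|l l' ll|l c ml|l c lm cm|p].
  + by apply: derivation_add => //; apply/derivation_mul/derivation_Dm.
  + case: ifP => _; first exact: u.
    by case: eqP => // el'; have -> : (l <= m.+1)%N = false by lia.
  + rewrite Dm_x // z; last by lia.
    have -> : l == m.+1 = false by lia.
      by rewrite mul0r mulr0 addr0.
  + rewrite Dm_x // big_nat_recr //= eqxx ltnn andbF.
    have -> : (l <= m.+1)%N by lia.
    have [->|lm1] := eqVneq l m.+1.
      rewrite z // big_nat big1 => [|l' lm']; last first.
        rewrite ltnn; have -> : l' == m.+1 = false by lia.
        by rewrite mul0r.
      rewrite add0r addr0 /Esub ej; have [->|cm2] := eqVneq c m.+2.
        by rewrite ltnn andbF b1 b0 xE; ring.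
      have -> : (0 < c <= m.+1)%N by lia.
      by rewrite b1 b0; ring.
    have lm' : (l <= m)%N by lia.
    rewrite mul0r mulr0 add0r.
    have -> : \sum_(1 <= l' < m.+1) (if (l <= m)%N && (l' <= m)%N then N l l' else
       if l' == m.+1 then x l i else 0) * x l' c = \sum_(1 <= l' < m.+1) N l l' * x l' c.
      by apply: eq_big_nat => l' l'm; have -> : (l <= m)%N && (l' <= m)%N by lia.
    rewrite /Esub ej; have [->|cm2] := eqVneq c m.+2.
      rewrite sum_row_gt xE x_gt; last by lia.
      by rewrite (der0 d) b1; ring.
    rewrite mul0r add0r a; [|lia|lia].
    rewrite addrC; congr (_ + _).
    have ir : c \in index_iota 1 m.+2 by rewrite mem_index_iota; lia.
    rewrite (bigD1_seq c ir (iota_uniq _ _)) /= /Esub eqxx mul1r big1 ?addr0 1?mulrC //.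
    by move=> s /negPf; rewrite eq_sym => ->; rewrite mul0r mulr0.
  + rewrite natES (negPf ei) ej eqxx o wtraceS (@eq_wtrace _ _ N).
      by rewrite scaler_nat -[_ * p *+ _]mulr_natl ltnn eqxx leqnn /=; ring.
    by move=> l lm; have -> : (l <= m)%N by lia.
- have [||D [N [d u z a o]]] := IH i j mn'; [lia|lia|].
  have j1 : (0 < j <= m.+1)%N by lia.
  exists (fun p => x m.+1 i * dx m.+1 j p + D p),
    (fun l l' => if (l <= m)%N && (l' <= m)%N then N l l' else 0).
  split=> [|l l' ll|l c ml|l c lm cm|p].
  + by apply: derivation_add => //; apply/derivation_mul/derivation_dx.
  + by case: ifP => _ //; exact: u.
  + rewrite dx_x // z; last by lia.
    have -> : l == m.+1 = false by lia.
      by rewrite mulr0 addr0.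
  + rewrite dx_x // big_nat_recr //= ltnn andbF mul0r addr0.
    have [->|lm1] := eqVneq l m.+1.
      rewrite z // big1 ?addr0 1?mulrC // => l' _.
      by rewrite ltnn mul0r.
    rewrite mulr0 add0r.
    have -> : \sum_(1 <= l' < m.+1) (if (l <= m)%N && (l' <= m)%N then N l l' else 0) * x l' c
        = \sum_(1 <= l' < m.+1) N l l' * x l' c.
      by apply: eq_big_nat => l' l'm; have -> : (l <= m)%N && (l' <= m)%N by lia.
    have [ec|cm2] := eqVneq c m.+2; last by rewrite a //; lia.
    rewrite ec sum_row_gt x_gt; last by lia.
    rewrite /Esub; have -> : m.+2 == j = false by lia.
    by rewrite (der0 d) b0 mul0r addr0.
  + rewrite natES (negPf ei) (negPf ej) o wtraceS (@eq_wtrace _ _ N).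
      by rewrite ltnn mulr0 addr0 addrA.
    by move=> l lm; have -> : (l <= m)%N by lia.
Qed.

End NatOp.

(** * Products of minors *)

Definition upd (T : eqType) (c : T -> nat) (s : T) (a : nat) : T -> nat :=
  fun s' => if s' == s then a else c s'.

Section Minors.
Variables (F : numFieldType) (n : nat) (k : nat -> nat).
Local Notation P := (pring F n).
Local Notation x := (@x F n).
Local Notation dx := (@dx F n).
Local Notation Dm := (@Dm F n).
Local Notation natE := (@natE F n k).
Local Notation kk := (mult n k).
Implicit Types (p q : P) (D : P -> P) (m : nat).

Definition cminor (i j : nat) (c : nat -> nat) : P :=
  \det (\matrix_(a < (i - j).+1, b < (i - j).+1) x (j + a) (c b)).
Local Notation minor := cminor.

Lemma eq_minor i j c c' : (forall s, (s <= i - j)%N -> c s = c' s) ->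
  minor i j c = minor i j c'.
Proof.
move=> e; congr (\det _); apply/matrixP => a b; rewrite !mxE e //.
by rewrite -ltnS.
Qed.

Lemma eq_cofactor_col N (A B : 'M[P]_N) (i s : 'I_N) :
  (forall (i' s' : 'I_N), s' != s -> A i' s' = B i' s') -> cofactor A i s = cofactor B i s.
Proof.
move=> e; congr (_ * \det _); apply/matrixP => a b; rewrite !mxE e //.
by rewrite eq_sym neq_lift.
Qed.

(** An upper triangular [N] sends a row to a combination of itself and later rows, all of which
    belong to a minor that ends at row m. By [A *m \adj A = det A] only the diagonal of [N]
    survives; the [Esub] part replaces one column at a time. *)
Lemma der_minor m (j : nat) (D : P -> P) (N : nat -> nat -> P) (c : nat -> nat) a b :
  derivation D -> (forall l l', (l' < l)%N -> N l l' = 0) ->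
  (forall l c, (1 <= l <= m)%N -> (1 <= c <= m.+1)%N ->
     D (x l c) = Esub F n a b l c + \sum_(1 <= l' < m.+1) N l l' * x l' c) ->
  (1 <= j <= m)%N -> (forall s, (s <= m - j)%N -> (1 <= c s <= m.+1)%N) ->
  D (minor m j c) = (\sum_(j <= l < m.+1) N l l) * minor m j c
    + \sum_(s < (m - j).+1) (c s == b)%:R * minor m j (upd c s a).
Proof.
move=> dD uN aD jm cm; pose A := \matrix_(a < (m - j).+1, b < (m - j).+1) x (j + a) (c b).
rewrite -[minor m j c]/(\det A) det_der //.
have DA i' s : D (A i' s) = (c s == b)%:R * x (j + i') a +
    \sum_(l < (m - j).+1) N (j + i')%N (j + l)%N * A l s.
  have := ltn_ord i'; have := ltn_ord s => sm im; rewrite mxE aD; [|lia|apply: cm; lia].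
  congr (_ + _); rewrite (@big_cat_nat _ _ _ j) /=; [|lia|lia].
  rewrite big_nat big1 ?add0r => [|l' lj]; last by rewrite uN ?mul0r //; lia.
  rewrite -{1}[j]add0n big_addn subSn ?big_mkord; last by lia.
  by apply: eq_bigr => l _; rewrite mxE [(_ + j)%N]addnC.
under eq_bigr do under eq_bigr do rewrite DA mulrDl.
under eq_bigr do rewrite big_split /=.
rewrite big_split /= addrC; congr (_ + _).
  have -> : \sum_(j <= l < m.+1) N l l = \sum_(l < (m - j).+1) N (j + l)%N (j + l)%N.
    rewrite -{1}[j]add0n big_addn subSn ?big_mkord; last by lia.
    by apply: eq_bigr => l _; rewrite [(_ + j)%N]addnC.
  rewrite mulr_suml; apply: eq_bigr => i' _.
  under eq_bigr do rewrite mulr_suml; rewrite exchange_big /=.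
  transitivity (\sum_(l < (m - j).+1) N (j + i')%N (j + l)%N * (A *m \adj A) l i').
    apply: eq_bigr => l _; rewrite mxE big_distrr; apply: eq_bigr => s _ /=.
    by rewrite mulrA [(\adj A) _ _]mxE.
  rewrite mul_mx_adj (bigD1 i') //= mxE eqxx mulr1n big1 ?addr0 //.
  by move=> l /negPf li; rewrite mxE li mulr0n mulr0.
rewrite exchange_big; apply: eq_bigr => s _ /=.
pose B := \matrix_(i' < (m - j).+1, s' < (m - j).+1) x (j + i') (upd c s a s').
rewrite -[minor m j (upd c s a)]/(\det B) (expand_det_col _ s) big_distrr.
apply: eq_bigr => i' _ /=.
have -> : cofactor A i' s = cofactor B i' s.
  apply: eq_cofactor_col => i1 s1 s1s.
  by rewrite !mxE /upd val_eqE (negPf s1s).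
have -> : B i' s = x (j + i') a by rewrite mxE /upd eqxx.
by rewrite -mulrA.
Qed.

(** Names for the factors of a product: [(j, t)] is the t-th minor with first row j. A slot is a
    column position in a factor. *)
Definition facs m := [seq (j, t) | j <- index_iota 1 m.+1, t <- iota 0 (kk j)].
Definition slots m := [seq (f, s) | f <- facs m, s <- iota 0 (m - f.1).+1].

Definition mprod m (c : nat * nat * nat -> nat) : P :=
  \prod_(f <- facs m) minor m f.1 (fun s => c (f, s)).

Lemma facs_uniq m : uniq (facs m).
Proof.
apply: allpairs_uniq_dep => [|j _|]; rewrite ?iota_uniq //.
by move=> [j t] [j' t'] _ _ /= [-> ->].
Qed.

Lemma mem_facs m f : (f \in facs m) = (1 <= f.1 <= m)%N && (f.2 < kk f.1)%N.
Proof.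
case: f => j t; apply/allpairsPdep/idP => /= [[j' [t' [h1 h2 [-> ->]]]]|h].
  by move: h1 h2; rewrite mem_index_iota mem_iota; lia.
by exists j, t; rewrite mem_index_iota mem_iota; split=> //; lia.
Qed.

Lemma mem_slots m f s : ((f, s) \in slots m) = (f \in facs m) && (s <= m - f.1)%N.
Proof.
apply/allpairsPdep/idP => [[j' [t' [h1 h2 [-> ->]]]]|/andP[h h']].
  by rewrite h1; move: h2; rewrite mem_iota add0n ltnS.
by exists f, s; rewrite h mem_iota add0n ltnS.
Qed.

Lemma eq_mprod m c c' : {in slots m, c =1 c'} -> mprod m c = mprod m c'.
Proof.
move=> e; apply: eq_big_seq => f fm; apply: eq_minor => s sm.
by apply: e; rewrite mem_slots fm.
Qed.

(** Leibniz' rule and [der_minor]: the partial traces of all the factors add up to [wtrace], which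
    is exactly the multiplication term subtracted in [lifts]. *)
Lemma natE_mprod m a b c : (m <= n)%N -> (1 <= a <= m.+1)%N -> (1 <= b <= m.+1)%N ->
  {in slots m, forall sl, (1 <= c sl <= m.+1)%N} ->
  natE m a b (mprod m c) =
  \sum_(sl <- slots m) (c sl == b)%:R * mprod m (upd c sl a).
Proof.
move=> mn am bm cm; have [D [N [d u _ aD o]]] := natE_lifts F k mn am bm.
rewrite /slots big_allpairs_dep o {1}/mprod (der_prod _ d (facs_uniq m)).
transitivity (\sum_(f <- facs m) ((\sum_(f.1 <= l < m.+1) N l l) * mprod m c
   + \sum_(s <- iota 0 (m - f.1).+1) (c (f, s) == b)%:R * mprod m (upd c (f, s) a))
   - wtrace k m N * mprod m c).
  congr (_ - _); apply: eq_big_seq => f fm.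
  have pf c' : mprod m c' = minor m f.1 (fun s => c' (f, s)) *
      \prod_(f' <- facs m | f' != f) minor m f'.1 (fun s => c' (f', s)).
    by rewrite /mprod (bigD1_seq f fm (facs_uniq m)).
  rewrite (@der_minor m f.1 D N _ a b d u aD); first last.
  - by move=> s sm; apply: cm; rewrite mem_slots fm.
  - by move: fm; rewrite mem_facs => /andP[].
  rewrite mulrDl -mulrA -pf; congr (_ + _).
  have -> : iota 0 (m - f.1).+1 = index_iota 0 (m - f.1).+1 by rewrite /index_iota subn0.
  rewrite mulr_suml big_mkord.
  apply: eq_bigr => s _; rewrite (pf (upd c _ _)) -[LHS]mulrA.
  have -> : minor m f.1 (fun s' => upd c (f, s : nat) a (f, s')) =
      minor m f.1 (upd (fun s' => c (f, s')) s a).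
    by apply: eq_minor => s' _; rewrite /upd xpair_eqE eqxx.
  have -> // : \prod_(f' <- facs m | f' != f) minor m f'.1 (fun s' => upd c (f, s : nat) a (f', s'))
      = \prod_(f' <- facs m | f' != f) minor m f'.1 (fun s' => c (f', s')).
  apply: eq_bigr => f' /negPf ff'; apply: eq_minor => s' _.
  by rewrite /upd xpair_eqE ff'.
have -> : wtrace k m N = \sum_(f <- facs m) \sum_(f.1 <= l < m.+1) N l l.
  rewrite [RHS]big_allpairs_dep; apply: eq_bigr => j _ /=.
  by rewrite big_const_seq count_predT size_iota iter_addr_0 mulr_natl.
rewrite big_split -mulr_suml addrAC subrr add0r.
by apply: eq_bigr => f _.
Qed.

End Minors.

(** * The reproducing kernel *)

Definition trow n (v : tri n) : nat := (val v).1.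
Definition tcol n (v : tri n) : nat := (val v).2.

Lemma tri_rc n (v : tri n) :
  tri_of n (trow v) (tcol v) = Some v /\ (0 < tcol v <= trow v)%N && (trow v <= n)%N.
Proof.
split; first exact: tri_of_val.
by have := ltn_ord (val v).1; have := valP v; rewrite /trow /tcol /=; lia.
Qed.

(** * Degree in the variables of a set of rows *)

Definition rowdeg (n : nat) (S : pred nat) (u : 'X_{1..#|tri n|}) : nat :=
  (\sum_(v : tri n | S (trow v)) u (enum_rank v))%N.

Lemma rowdeg0 n S : @rowdeg n S 0%MM = 0%N.
Proof. by rewrite /rowdeg big1 // => v _; rewrite mnm0E. Qed.

Lemma rowdegD n S : {morph @rowdeg n S : u v / (u + v)%MM >-> (u + v)%N}.
Proof.
by move=> u v; rewrite /rowdeg -big_split; apply: eq_bigr => w _; rewrite mnmDE.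
Qed.

HB.instance Definition _ n S := isMeasure.Build #|tri n| (@rowdeg n S) (@rowdeg0 n S) (@rowdegD n S).

Section Homog.
Variables (F : numFieldType) (n : nat) (S : pred nat).
Local Notation P := (pring F n).
Local Notation x := (@x F n).

Lemma dhomog_bigprod (I : eqType) (r : seq I) (Q : pred I) (dg : I -> nat) (f : I -> P) :
  (forall t, t \in r -> Q t -> f t \is (dg t).-homog for @rowdeg n S) ->
  \prod_(t <- r | Q t) f t \is (\sum_(t <- r | Q t) dg t).-homog for @rowdeg n S.
Proof.
elim: r => [_|t r IH H]; first by rewrite !big_nil dhomog1.
have {}IH := IH (fun t' t'r => H t' (mem_behead (s := t :: r) t'r)).
by rewrite !big_cons; case: ifP => // Qt; rewrite dhomogM ?H ?mem_head.
Qed.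

(** In a row that counts, the entry must be a variable: the constant -1 would have degree 0 instead
    of 1. *)
Lemma x_dhomog (l c : nat) : (S l -> 0 < c <= l /\ l <= n)%N ->
  x l c \is (S l : nat).-homog for @rowdeg n S.
Proof.
move=> Sl; rewrite /x; have := tri_ofP n l c; case: tri_of => [v [h h' e]|h].
  rewrite dhomogX; apply/eqP; rewrite /= /rowdeg.
  have vl : trow v = l :> nat by rewrite /trow e /= inordK.
  case Sl': (S l).
    rewrite (bigD1 v) /=; last by rewrite vl.
    rewrite mnm1E eqxx big1 ?addn0 // => w /andP[_ wv].
    by rewrite mnm1E (inj_eq enum_rank_inj) eq_sym (negPf wv).
  rewrite big1 // => w Sw; rewrite mnm1E (inj_eq enum_rank_inj).
  by case: eqP => // vw; move: Sw; rewrite -vw vl Sl'.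
have -> : S l = false by apply/negP => /Sl; lia.
by case: eqP => _; rewrite ?rpred0 // rpredN dhomog1.
Qed.

Lemma det_dhomog N (A : 'M[P]_N) (dg : 'I_N -> nat) :
  (forall i j, A i j \is (dg i).-homog for @rowdeg n S) ->
  \det A \is (\sum_i dg i)%N.-homog for @rowdeg n S.
Proof.
move=> hA; apply: rpred_sum => s _; rewrite mulr_sign; case: (odd_perm s).
  by rewrite rpredN; apply: dhomog_bigprod.
by apply: dhomog_bigprod.
Qed.

Lemma minor_dhomog (i j : nat) (c : nat -> nat) :
  (forall l s, (j <= l <= i)%N -> S l -> (s <= i - j)%N -> (0 < c s <= l)%N /\ (l <= n)%N) ->
  (j <= i)%N ->
  cminor F n i j c \is (\sum_(a < (i - j).+1) S (j + a)%N)%N.-homog for @rowdeg n S.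
Proof.
move=> h ji; apply: det_dhomog => a b; rewrite mxE; apply: x_dhomog => Sl.
by have := ltn_ord a; have := ltn_ord b => hb ha; apply: h => //; lia.
Qed.

End Homog.

Lemma slots_uniq n k m : uniq (slots n k m).
Proof.
apply: allpairs_uniq_dep => [|f _|]; rewrite ?facs_uniq ?iota_uniq //.
by move=> [f s] [f' s'] _ _ [-> ->].
Qed.

Lemma big_seq_sub (V : nmodType) (T : choiceType) (s : seq T) (G : T -> V) : uniq s ->
  \sum_(i <- s) G i = \sum_(t : seq_sub s) G (val t).
Proof.
move=> us; rewrite -(big_map val xpredT G); apply: perm_big; apply: uniq_perm => //.
  by rewrite map_inj_uniq ?index_enum_uniq //; exact: val_inj.
move=> i; apply/idP/mapP => [si|[t _ ->]]; last exact: ssvalP.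
by exists (SeqSub si); rewrite ?mem_index_enum.
Qed.

(** * Coefficients of products of minors and of their kernel *)

Section Coefficients.
Variables (F : numFieldType) (n : nat) (k : nat -> nat).
Local Notation P := (pring F n).
Local Notation x := (@x F n).
Local Notation dx := (@dx F n).
Local Notation natE := (@natE F n k).
Local Notation mprod := (@mprod F n k).
Local Notation slots := (slots n k).
Implicit Types (p q : P) (m : nat) (u : 'X_{1..#|tri n|}) (v w : tri n).
Local Notation row v := (trow v).
Local Notation col v := (tcol v).

Lemma mprod_dhomog (S : pred nat) m c :
  (forall l, (l <= m)%N -> ~~ S l) ->
  mprod m c \is 0%N.-homog for @rowdeg n S.
Proof.
move=> Sm; have : mprod m c \is (\sum_(f <- facs n k m) 0)%N.-homog for @rowdeg n S.
  apply: dhomog_bigprod => f; rewrite mem_facs => fm _.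
  have := @minor_dhomog F n S m f.1 (fun s => c (f, s)).
  have -> : (\sum_(a < (m - f.1).+1) S (f.1 + a)%N = 0)%N.
    by apply: big1 => a _; have := ltn_ord a => am; rewrite (negPf (Sm _ _)) //; lia.
  by apply=> [l s lm Sl|]; [have := Sm l; rewrite Sl; lia|lia].
by rewrite big1.
Qed.

Lemma mcoeffXM0 v q u : u (enum_rank v) = 0%N -> ('X_(enum_rank v) * q)@_u = 0.
Proof.
move=> uv; apply/eqP; rewrite mcoeff_eq0 mulrC (perm_mem (msuppMX _ _)).
by apply/mapP => -[u' _ e]; move: uv; rewrite e mnmDE mnm1E eqxx.
Qed.

Lemma mcoeff_xM0 (l c : nat) q u : (0 < c <= l)%N -> (l <= n)%N ->
  (forall v, row v = l -> col v = c -> u (enum_rank v) = 0%N) -> (x l c * q)@_u = 0.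
Proof.
move=> cl ln h; rewrite /x; have [v -> [v1 v2]] := tri_of_some cl ln.
by apply: mcoeffXM0; apply: h.
Qed.

Lemma mcoeff_raise m v u p : (row v <= m <= n)%N ->
  (forall w, (row v < row w)%N -> u (enum_rank w) = 0%N) ->
  (natE m (row v).+1 (col v) p)@_u =
  - (p@_(u + U_(enum_rank v)) *+ (u (enum_rank v)).+1).
Proof.
have [vE vP] := tri_rc v; elim: m => [|m IH] vm hu; first by lia.
rewrite natES eqSS; have [e|ne] := eqVneq (row v) m.+1.
  have -> : (col v == m.+2) = false by lia.
  by rewrite mcoeffN /dx -e vE mcoeff_deriv.
have -> : (col v == m.+2) = false by lia.
rewrite mcoeffD IH //; last by lia.
rewrite mcoeff_xM0 ?add0r //; [lia|lia|].
by move=> w wl wc; apply: hu; lia.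
Qed.

(** For i < j every term of the operator is a multiple of a variable. *)
Lemma mcoeff_lower m (i j : nat) p : (m <= n)%N -> (0 < i < j)%N -> (j <= m.+1)%N ->
  (natE m i j p)@_0%MM = 0.
Proof.
elim: m p => [|m IH] p mn ij jm; first by lia.
have x0 l c q : (0 < c <= l)%N -> (l <= n)%N -> (x l c * q)@_0%MM = 0.
  by move=> cl ln; apply: mcoeff_xM0 => // v _ _; rewrite mnm0E.
rewrite natES; have -> : (i == m.+2) = false by lia.
case: eqP => [ej|ej]; last by rewrite mcoeffD x0 ?IH ?addr0 //; lia.
rewrite mcoeffB mcoeffD mcoeffZ !x0; [|lia..].
rewrite mulr0 subr0 add0r raddf_sum big_nat big1 // => r rm.
by rewrite /= x0 //; lia.
Qed.

Lemma top_var u : u != 0%MM -> exists v, (0 < u (enum_rank v))%N /\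
  forall w, (row v < row w)%N -> u (enum_rank w) = 0%N.
Proof.
move=> u0; have [t ut] : exists t, (0 < u t)%N.
  apply/existsP; apply: contraNT u0; rewrite negb_exists => /forallP h.
  by apply/eqP/mnmP => t; rewrite mnm0E; have := h t; lia.
have v0 : (0 < u (enum_rank (enum_val t)))%N by rewrite enum_valK.
case: (@arg_maxnP _ (enum_val t) (fun v => (0 < u (enum_rank v))%N) (fun v => row v) v0) => v uv vmax.
exists v; split=> // w; have := vmax w; rewrite /=.
by case: (u (enum_rank w)) => // ? /(_ isT) ; lia.
Qed.

Section Kernel.
Variable m : nat.

Definition slotT := seq_sub (slots m).
(** The value 1 off the slots keeps all column indices within [1..m+1]. *)
Definition assig (a : {ffun slotT -> 'I_m.+1}) (sl : nat * nat * nat) : nat :=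
  if insub sl is Some t then (a (t : slotT)).+1 else 1%N.
(* The coefficient of z^u in F(x, z). *)
Definition kerc u : P :=
  \sum_(a : {ffun slotT -> 'I_m.+1}) (mprod m (assig a))@_u *: mprod m (assig a).

Lemma assig_bound a sl : (1 <= assig a sl <= m.+1)%N.
Proof. by rewrite /assig; case: insubP => // t _ _; have := ltn_ord (a t); lia. Qed.

Lemma assig_surj c : {in slots m, forall sl, (1 <= c sl <= m.+1)%N} ->
  exists a, {in slots m, c =1 assig a}.
Proof.
move=> hc; exists [ffun t : slotT => inord (c (val t)).-1] => sl slm.
rewrite /assig; case: insubP => [t _ e|]; last by rewrite slm.
by rewrite ffunE e inordK; have := hc _ slm; lia.
Qed.

Definition fupd (a : {ffun slotT -> 'I_m.+1}) (t : slotT) (i : 'I_m.+1) :=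
  [ffun t' => if t' == t then i else a t'].

Lemma assig_upd a (t : slotT) (i : 'I_m.+1) : 
  {in slots m, upd (assig a) (val t) i.+1 =1 assig (fupd a t i)}.
Proof.
move=> sl slm; rewrite /upd /assig; case: insubP => [t' _ <-|]; last by rewrite slm.
by rewrite ffunE (inj_eq val_inj); case: eqP.
Qed.

Hypothesis mn : (m <= n)%N.

Lemma natE_assig (i j : 'I_m.+1) a :
  natE m i.+1 j.+1 (mprod m (assig a)) =
  \sum_(t : slotT | a t == j) mprod m (assig (fupd a t i)).
Proof.
rewrite natE_mprod ?ltn_ord //; last by move=> sl _; apply: assig_bound.
rewrite [RHS]big_mkcond.
transitivity (\sum_(t : slotT) ((assig a (val t) == j.+1)%:R * mprod m (upd (assig a) (val t) i.+1) : P)).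
  by rewrite (big_seq_sub (fun sl => (assig a sl == j.+1)%:R * mprod m (upd (assig a) sl i.+1)) (slots_uniq n k m)).
apply: eq_bigr => t _; rewrite (eq_mprod _ (@assig_upd a t i)) /assig valK eqSS.
by rewrite val_eqE; case: ifP => _; rewrite ?mul1r ?mul0r.
Qed.

Lemma natE_sumZ i j (I : Type) (r : seq I) (a : I -> F) (f : I -> P) :
  natE m i j (\sum_(t <- r) a t *: f t) = \sum_(t <- r) a t *: natE m i j (f t).
Proof.
have [nD nZ] := @natE_lin F n k m i j.
elim: r => [|t r IH]; last by rewrite !big_cons nD nZ IH.
by rewrite !big_nil; have := nZ 0 0; rewrite !scale0r.
Qed.

(** At a fixed slot, changing the value is a bijection between the families with value j and those
    with value i. Replacing j by i in one factor of the kernel is thus the transpose of replacing i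
    by j in the other. *)
Lemma natE_kerc (i j : 'I_m.+1) u : natE m i.+1 j.+1 (kerc u) =
  \sum_a (natE m j.+1 i.+1 (mprod m (assig a)))@_u *: mprod m (assig a).
Proof.
rewrite /kerc natE_sumZ.
under eq_bigr do rewrite natE_assig scaler_sumr.
under [RHS]eq_bigr do rewrite natE_assig raddf_sum scaler_suml.
rewrite [LHS](exchange_big_dep xpredT); last by [].
rewrite [RHS](exchange_big_dep xpredT) /=; last by [].
apply: eq_bigr => t _; have fupdK (a : {ffun slotT -> 'I_m.+1}) i1 i2 : a t = i1 -> fupd (fupd a t i2) t i1 = a.
  move=> e; apply/ffunP => t'; rewrite !ffunE.
  by case: eqP => [->|]; rewrite ?e.
rewrite [RHS](reindex_onto (fun a => fupd a t i) (fun a => fupd a t j)); last first.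
  by move=> a /eqP; apply: fupdK.
apply: eq_big => a /=.
  rewrite ffunE !eqxx /=; apply/eqP/eqP => [/fupdK -> //|<-].
  by rewrite ffunE eqxx.
by move/eqP => e; rewrite (fupdK _ _ _ e).
Qed.

Lemma mprod_out c u v : (m < row v)%N -> (0 < u (enum_rank v))%N ->
  (mprod m c)@_u = 0.
Proof.
move=> mv uv; apply/eqP; rewrite mcoeff_eq0; apply/negP => um.
have := @mprod_dhomog (fun l => m < l)%N m c.
have Sm l : (l <= m)%N -> ~~ (m < l)%N by rewrite ltnNge => ->.
move=> /(_ Sm) /dhomogP /(_ u um); rewrite /= /rowdeg (bigD1 v) //=.
by move=> /eqP; rewrite addn_eq0 => /andP[/eqP e _]; rewrite e in uv.
Qed.

Lemma kerc_swap u u' : (kerc u)@_u' = (kerc u')@_u.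
Proof.
by rewrite /kerc !raddf_sum; apply: eq_bigr => a _; rewrite /= !mcoeffZ mulrC.
Qed.

Lemma kerc_out u v : (m < row v)%N -> (0 < u (enum_rank v))%N -> kerc u = 0.
Proof.
by move=> mv uv; rewrite /kerc big1 // => a _; rewrite (mprod_out _ mv uv) scale0r.
Qed.

Lemma kerc_raise u v : (row v <= m)%N ->
  (forall w, (row v < row w)%N -> u (enum_rank w) = 0%N) ->
  natE m (col v) (row v).+1 (kerc u) =
  - (((u (enum_rank v)).+1)%:R *: kerc (u + U_(enum_rank v))).
Proof.
move=> vm hu; have [_ vP] := tri_rc v.
have hi : ((col v).-1 < m.+1)%N by lia.
have hj : (row v < m.+1)%N by lia.
have /= := natE_kerc (Ordinal hi) (Ordinal hj) u; rewrite prednK => [->|]; last by lia.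
rewrite /kerc scaler_sumr -sumrN; apply: eq_bigr => a _.
rewrite mcoeff_raise //; last by lia.
by rewrite scaleNr scalerA mulr_natl.
Qed.

Lemma kerc0 : exists a, kerc 0%MM = a *: 1.
Proof.
exists (kerc 0%MM)@_0%MM; apply/mpolyP => u; rewrite mcoeffZ mcoeff1.
have [->|u0] := eqVneq u 0%MM; first by rewrite mulr1.
rewrite mulr0 kerc_swap; have [v [uv hv]] := top_var u0.
have [vm|vm] := leqP (row v) m; last by rewrite (kerc_out vm uv) mcoeff0.
pose u' := (u - U_(enum_rank v))%MM.
have eu : u = (u' + U_(enum_rank v))%MM.
  by rewrite submK //; apply/mnm_lepP => t; rewrite mnm1E; have [<-|] := eqVneq (enum_rank v) t.
have hu' w : (row v < row w)%N -> u' (enum_rank w) = 0%N by move=> vw; rewrite mnmBE hv.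
have := kerc_raise vm hu'; move/(congr1 (mcoeff 0%MM)); rewrite -eu mcoeff_lower //; [|by have [_] := tri_rc v; lia..].
rewrite mcoeffN mcoeffZ => /esym/eqP; rewrite oppr_eq0 mulf_eq0 pnatr_eq0 /=.
by move/eqP.
Qed.

(** Induction on the degree of u: remove a variable of the highest row present and apply
    [kerc_raise], dividing by the exponent in characteristic zero. *)
Lemma kerc_mem (C : P -> Prop) u : subspace C -> C 1 ->
  (forall i j p, (1 <= i <= m.+1)%N -> (1 <= j <= m.+1)%N -> i != j -> C p -> C (natE m i j p)) ->
  C (kerc u).
Proof.
move=> [C0 CD CZ] C1 CE; have [d] := ubnP (mdeg u); elim: d u => // d IH u ud.
have [->|u0] := eqVneq u 0%MM.
  by have [a ->] := kerc0; apply: CZ.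
have [v [uv hv]] := top_var u0.
have [vm|vm] := leqP (row v) m; last by rewrite (kerc_out vm uv).
pose u' := (u - U_(enum_rank v))%MM.
have eu : u = (u' + U_(enum_rank v))%MM.
  by rewrite submK //; apply/mnm_lepP => t; rewrite mnm1E; have [<-|] := eqVneq (enum_rank v) t.
have hu' w : (row v < row w)%N -> u' (enum_rank w) = 0%N by move=> vw; rewrite mnmBE hv.
have := kerc_raise vm hu'; rewrite -eu => e.
have -> : kerc u = (- ((u' (enum_rank v)).+1%:R)^-1) *: natE m (col v) (row v).+1 (kerc u').
  by rewrite e scalerN scaleNr opprK scalerA mulVf ?scale1r // pnatr_eq0.
apply: CZ; have [_ vP] := tri_rc v; apply: CE; [lia|lia|lia|apply: IH].
by move: ud; rewrite eu mdegD mdeg1; lia.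
Qed.

End Kernel.
End Coefficients.

(** * Gram matrices of real matrices *)

Section Gram.
Variable F : numClosedFieldType.

Lemma conj_tr_mulmx_eq0 (M N : nat) (Y : 'M[F]_(M, N)) :
  (map_mx Num.conj Y)^T *m Y = 0 -> Y = 0.
Proof.
move=> YY; apply/matrixP => i j; rewrite [RHS]mxE; apply/eqP.
have := congr1 (fun Z : 'M[F]_N => Z j j) YY; rewrite !mxE => /eqP.
rewrite psumr_eq0 => [/allP /(_ i)|t _]; last by rewrite !mxE mulrC mul_conjC_ge0.
by rewrite mem_index_enum !mxE mulrC mul_conjC_eq0 => /(_ isT).
Qed.

(** Let C be the cokernel of [A^T *m A] and Y = A C. As A is real, the conjugate transpose of Y
    times Y contains [A^T *m A] times C, which is zero; positivity gives Y = 0. *)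
Lemma gram_submx (M N : nat) (A : 'M[F]_(M, N)) :
  map_mx Num.conj A = A -> (A <= A^T *m A)%MS.
Proof.
move=> rA; rewrite submxE; apply/eqP/conj_tr_mulmx_eq0.
by rewrite map_mxM rA trmx_mul -mulmxA [A^T *m (A *m _)]mulmxA mulmx_coker mulmx0.
Qed.

End Gram.

(** * Laplace expansions and graded families *)

Section Laplace.
Variables (F : numFieldType) (n : nat).
Local Notation P := (pring F n).
Local Notation x := (@x F n).
Local Notation minor := (cminor F n).
Implicit Types (N i j : nat) (c : nat -> nat).

(** Indexed by its size, so that expansions may reach the empty minor 1, which [cminor] excludes. *)
Definition minorN N j c : P := \det (\matrix_(a < N, b < N) x (j + a) (c b)).

Lemma minorN_last_row N j c : minorN N.+1 j c =
  \sum_(s < N.+1) (-1) ^+ (N + s) * (x (j + N) (c s) * minorN N j (fun b => c (bump s b))).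
Proof.
rewrite /minorN (expand_det_row _ ord_max); apply: eq_bigr => s _.
rewrite mxE /cofactor mulrCA; congr (_ * (_ * \det _)); apply/matrixP => a b.
by rewrite !mxE lift_max.
Qed.

Lemma minorN_col0 N j c b : (b < N)%N -> (j + N < c b)%N -> minorN N j c = 0.
Proof.
move=> bN cb; rewrite /minorN (expand_det_col _ (Ordinal bN)) big1 // => a _.
by rewrite mxE x_gt ?mul0r //=; have := ltn_ord a; lia.
Qed.

(** On the rows [j..j+N], column j+N+1 is zero except for -1 in the last row. *)
Lemma minorN_col_last N j c s : (s <= N)%N -> c s = (j + N).+1 ->
  minorN N.+1 j c = (-1) ^+ (N + s).+1 * minorN N j (fun b => c (bump s b)).
Proof.
move=> sN cs; rewrite minorN_last_row (bigD1 (Ordinal (sN : s < N.+1)%N)) //=.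
rewrite cs xE mulN1r mulrN exprS mulN1r mulNr big1 ?addr0 // => t ts.
case: N sN cs t ts => [|N] sN cs t ts.
  case/eqP: ts; apply: ord_inj => /=.
  by move: (ltn_ord t) sN; rewrite ltnS !leqn0 => /eqP-> /eqP->.
have nts : s != t by apply: contraNneq ts => e; apply/eqP/ord_inj; rewrite /= e.
have e : bump t (unbump t s) = s by rewrite unbumpK // inE.
(* Every other term of the expansion still contains column s, now at position [unbump t s], without
   the last row. *)
rewrite (@minorN_col0 N.+1 j (fun b => c (bump t b)) (unbump t s)) ?mulr0 ?e ?cs //.
have [st|st] : (s < t \/ t < s)%N by apply/orP; rewrite -neq_ltn.
  have -> : unbump t s = s by rewrite /unbump ltnNge (ltnW st) subn0.
  by apply: leq_trans st _; rewrite -ltnS.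
by rewrite /unbump st subn1; lia.
Qed.

(** Bordering by the column whose only entry is -1 in the new row. In this way minors that stop at
    row i < n are written as minors that reach row n. *)
Lemma minorN_up N j c : minorN N j c =
  - minorN N.+1 j (fun b => if b == N then (j + N).+1 else c b).
Proof.
rewrite (@minorN_col_last N j _ N) //= ?eqxx // addnn exprS -signr_odd odd_double.
rewrite expr0 mulr1 mulN1r opprK; congr (\det _); apply/matrixP => a b.
by rewrite !mxE /bump; have bN := ltn_ord b; rewrite leqNgt bN /= add0n ltn_eqF.
Qed.

Lemma minorN_diag N j : minorN N j (fun s => (j + s).+1) = (-1) ^+ N.
Proof.
rewrite /minorN det_trig; last first.
  by apply/is_trig_mxP => a b ab; rewrite mxE x_gt //; lia.
rewrite (eq_bigr (fun=> -1)) => [|a _]; last by rewrite mxE xE.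
by rewrite prodr_const card_ord.
Qed.

End Laplace.

(** * Multiplicative families indexed by weights *)

Section Graded.
Variables (F : numFieldType) (n : nat).
Local Notation P := (pring F n).
Local Notation x := (@x F n).
Local Notation minor := (cminor F n).
Local Notation kk := (mult n).
Local Notation facs := (facs n).
Local Notation mprod := (@mprod F n).
Implicit Types (k : nat -> nat) (G : (nat -> nat) -> P -> Prop) (p q : P) (m : nat).

(** The fundamental weight that allows exactly one minor, with first row j0. *)
Definition delta (j0 t : nat) : nat := (t == n - j0 + 1)%N.

Lemma kk_delta j0 j : (j0 <= n)%N -> (j <= n)%N -> kk (delta j0) j = (j == j0).
Proof. by move=> h h'; rewrite /mult /delta; congr (nat_of_bool _); lia. Qed.

(** To place a product in [G k] it is enough to place each factor with first row j in [G (delta j)].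
    The last field lets a product have fewer factors than allowed, and identifies weights with equal
    multiplicities up to m. *)
Record graded m G : Prop := Graded {
  graded1 : forall k, G k 1;
  gradedM : forall k1 k2 p q, G k1 p -> G k2 q -> G (fun t => k1 t + k2 t)%N (p * q);
  gradedS : forall k1 k2 p,
    (forall j, (1 <= j <= m)%N -> (kk k1 j <= kk k2 j)%N) -> G k1 p -> G k2 p }.

Lemma graded_prod m G (I : eqType) (r : seq I) (Q : pred I) (K : I -> nat -> nat) (f : I -> P) :
  graded m G -> (forall i, i \in r -> Q i -> G (K i) (f i)) ->
  G (fun t => \sum_(i <- r | Q i) K i t)%N (\prod_(i <- r | Q i) f i).
Proof.
move=> gG; elim: r => [_|i r IH H].
  by rewrite big_nil; apply: (graded1 gG).
have {}IH := IH (fun i' i'r => H i' (mem_behead (s := i :: r) i'r)).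
rewrite big_cons; case: ifP => Qi; last first.
  by apply: (gradedS gG) IH => j _; rewrite /mult big_cons Qi.
have := gradedM gG (H i (mem_head _ _) Qi) IH.
by apply: (gradedS gG) => j _; rewrite /mult big_cons Qi.
Qed.

Lemma graded_exp m G K p e : graded m G -> G K p -> G (fun t => e * K t)%N (p ^+ e).
Proof.
move=> gG Gp; elim: e => [|e IH]; first by rewrite expr0; apply: (graded1 gG).
rewrite exprS; apply: (gradedS gG) (gradedM gG Gp IH) => j _.
by rewrite /mult mulSn.
Qed.

Lemma mprodE k m c : mprod k m c =
  \prod_(1 <= j < m.+1) \prod_(t <- iota 0 (kk k j)) minor m j (fun s => c (j, t, s)).
Proof. by rewrite /mprod /facs big_allpairs_dep. Qed.

Lemma graded_mprod m0 m k c G : (m <= n)%N -> graded m0 G ->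
  (forall j c, (1 <= j <= m)%N -> (forall s, 1 <= c s <= m.+1)%N -> G (delta j) (minor m j c)) ->
  (m <= m0 <= n)%N ->
  (forall sl, 1 <= c sl <= m.+1)%N -> G k (mprod k m c).
Proof.
move=> mn gG Gm m0n hc.
have H f : f \in facs k m -> true -> G (delta f.1) (minor m f.1 (fun s => c (f, s))).
  by rewrite mem_facs => /andP[fm _] _; apply: Gm.
have := graded_prod gG H.
apply: (gradedS gG) => j jm; rewrite /mult -/(mult n _ j) /facs big_allpairs_dep /=.
have [jm'|jm'] := leqP j m; last first.
  rewrite big_nat big1 // => i im; rewrite big1 // => t _.
  by rewrite -/(kk (delta i) j) kk_delta; [case: eqP; lia|lia|lia].
have ir : j \in index_iota 1 m.+1 by rewrite mem_index_iota; lia.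
rewrite (bigD1_seq j ir (iota_uniq _ _)) /= -/(kk (delta j) j) kk_delta; [|lia|lia].
rewrite eqxx big_const_seq count_predT size_iota iter_addn_0 mul1n.
rewrite big_nat_cond big1 ?addn0 // => i /andP[im ij].
rewrite big1 // => t _; rewrite -/(kk (delta i) j) kk_delta; [|lia|lia].
by rewrite eq_sym (negPf ij).
Qed.

Definition mprod_gen k m p := exists2 c, (forall sl, 1 <= c sl <= m.+1)%N & p = mprod k m c.
Definition mprod_span k m := linspan (mprod_gen k m).
Local Notation Qs := mprod_span.

Lemma mprod_gen1 k m : (m <= n)%N -> exists e, mprod_gen k m ((-1) ^+ e).
Proof.
(* Columns j+1, ..., m+1 make each minor triangular with diagonal -1; [minn] only enforces the bound
   off the slots. *)
move=> mn; pose c (sl : nat * nat * nat) := minn (sl.1.1 + sl.2).+1 m.+1.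
have [e he] : exists e, mprod k m c = (-1) ^+ e.
  rewrite /mprod big_seq; elim/big_ind: _ => [|p q [e1 ->] [e2 ->]|[j t]].
  - by exists 0%N.
  - by exists (e1 + e2)%N; rewrite exprD.
  rewrite mem_facs => /andP[/= jm _]; exists (m - j).+1; rewrite -(minorN_diag F n _ j).
  by apply: eq_minor => s sm; rewrite /c /=; lia.
by exists e, c => // sl; rewrite /c; lia.
Qed.

Lemma Qs1 k m : (m <= n)%N -> Qs k m 1.
Proof.
move=> mn; have [e he] := mprod_gen1 k mn.
have -> : 1 = (-1) ^+ e *: ((-1) ^+ e : P).
  elim: e {he} => [|e IH]; first by rewrite !expr0 scale1r.
  by rewrite !exprS !mulN1r scaleNr scalerN opprK.
exact/linspanZ/mem_linspan.
Qed.

Lemma eq_Qs k1 k2 m p : (forall j, (1 <= j <= m)%N -> kk k1 j = kk k2 j) ->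
  Qs k1 m p -> Qs k2 m p.
Proof.
move=> e; apply: linspan_sub => q [c hc ->]; apply: mem_linspan; exists c => //.
by rewrite !mprodE; apply: eq_big_nat => j jm; rewrite e //; lia.
Qed.

Lemma QsM k1 k2 m p q : Qs k1 m p -> Qs k2 m q -> Qs (fun t => k1 t + k2 t)%N m (p * q).
Proof.
apply: linspanM => _ _ [c1 h1 ->] [c2 h2 ->]; apply: mem_linspan.
(* For each first row, the factors of the first product are listed before those of the second. *)
pose c (sl : nat * nat * nat) := if (sl.1.2 < kk k1 sl.1.1)%N then c1 sl
  else c2 (sl.1.1, sl.1.2 - kk k1 sl.1.1, sl.2)%N.
exists c; first by move=> sl; rewrite /c; case: ifP.
rewrite !mprodE -big_split; apply: eq_bigr => j _ /=.
have -> : kk (fun t => k1 t + k2 t)%N j = (kk k1 j + kk k2 j)%N by [].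
rewrite iotaD big_cat; have -> : \prod_(t <- iota 0 (kk k1 j)) minor m j (fun s => c (j, t, s))
    = \prod_(t <- iota 0 (kk k1 j)) minor m j (fun s => c1 (j, t, s)).
  by apply: eq_big_seq => t; rewrite mem_iota /c => /andP[_ /= ->].
have -> : iota (0 + kk k1 j) (kk k2 j) = [seq (kk k1 j + t)%N | t <- iota 0 (kk k2 j)].
  by rewrite -iotaDl addn0.
rewrite big_map; have -> // : \prod_(t <- iota 0 (kk k2 j)) minor m j (fun s => c (j, (kk k1 j + t)%N, s))
    = \prod_(t <- iota 0 (kk k2 j)) minor m j (fun s => c2 (j, t, s)).
apply: eq_bigr => t _; apply: eq_minor => s _ /=.
by rewrite /c /= ltnNge leq_addr /= addKn.
Qed.

(** Monotonicity in the weight: the missing factors are supplied by 1, which lies in the span for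
    every weight. *)
Lemma graded_mprod_span m : (m <= n)%N -> graded m (Qs^~ m).
Proof.
move=> mn; split=> [k|k1 k2 p q|k1 k2 p h Qp]; first exact: Qs1.
  exact: QsM.
rewrite -[p]mulr1; apply: eq_Qs (QsM Qp (Qs1 (fun t => k2 t - k1 t)%N mn)) => j jm.
by have := h j jm; rewrite /mult; lia.
Qed.

Lemma Qs_minor m j c : (1 <= j <= m)%N -> (m <= n)%N -> (forall s, 1 <= c s <= m.+1)%N ->
  Qs (delta j) m (minor m j c).
Proof.
move=> jm mn hc; apply: mem_linspan; exists (fun sl => c sl.2) => // .
have ir : j \in index_iota 1 m.+1 by rewrite mem_index_iota; lia.
rewrite mprodE (bigD1_seq j ir (iota_uniq _ _)) /= kk_delta; [|lia|lia].
rewrite eqxx big_seq1 big_nat_cond big1 ?mulr1 // => i /andP[im ij].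
by rewrite kk_delta ?(negPf ij) ?big_nil //; lia.
Qed.

Lemma Qs_minor_low m i j c : (1 <= j <= i)%N -> (i <= m <= n)%N -> (forall s, 1 <= c s <= m.+1)%N ->
  Qs (delta j) m (minor i j c).
Proof.
move=> ji /andP[im mn]; have [d] := ubnP (m - i); elim: d i c ji im => // d IH i c ji im id hc.
have [e|ne] := eqVneq i m; first by rewrite e; apply: Qs_minor => //; lia.
rewrite -[minor i j c]/(minorN F n (i - j).+1 j c) minorN_up; apply: linspanN.
have -> : (i - j).+2 = (i.+1 - j).+1 by lia.
by apply: IH => [|||s]; [lia|lia|lia|]; case: ifP => _ //; lia.
Qed.

End Graded.

(** * The modules V^(m) *)

Section Module.
Variables (F : numClosedFieldType) (n : nat) (k : nat -> nat).
Local Notation P := (pring F n).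
Local Notation x := (@x F n).
Local Notation minor := (cminor F n).
Local Notation mprod := (@mprod F n k).
Local Notation natE := (@natE F n k).
Local Notation Qs := (@mprod_span F n).
Implicit Types (p q : P) (m : nat) (C : P -> Prop).

Definition stable m C := forall i j p,
  (1 <= i <= m.+1)%N -> (1 <= j <= m.+1)%N -> i != j -> C p -> C (natE m i j p).

Lemma subspace_natE m i j C : subspace C -> subspace (fun p => C (natE m i j p)).
Proof.
case=> C0 CD CZ; have [nD nZ] := @natE_lin F n k m i j; split.
- by have := nZ 0 0; rewrite !scale0r => ->.
- by move=> p q Cp Cq; rewrite nD; apply: CD.
- by move=> a p Cp; rewrite nZ; apply: CZ.
Qed.

Lemma Qs_natE m i j p : (m <= n)%N -> (1 <= i <= m.+1)%N -> (1 <= j <= m.+1)%N ->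
  Qs k m p -> Qs k m (natE m i j p).
Proof.
move=> mn im jm; apply: (@linspan_min _ _ _ (fun p => Qs k m (natE m i j p))).
  exact/subspace_natE/linspan_subspace.
move=> _ [c hc ->]; rewrite natE_mprod //; apply: linspan_sum => sl _.
case: eqP => _; rewrite ?mul0r ?mul1r; last exact: linspan0.
by apply: mem_linspan; exists (upd c sl i) => // sl'; rewrite /upd; case: ifP.
Qed.

Lemma mprod_real m c : map_mpoly Num.conj (mprod m c) = mprod m c.
Proof.
rewrite rmorph_prod; apply: eq_bigr => f _; rewrite /cminor -det_map_mx.
congr (\det _); apply/matrixP => a b; rewrite !mxE /Defs.x.
case: tri_of => [v|]; first by rewrite /= map_mpolyX.
by case: eqP => _; rewrite ?rmorphN ?rmorph1 ?rmorph0.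
Qed.

Lemma Qs_min m C p : (m <= n)%N -> subspace C -> C 1 -> stable m C -> Qs k m p -> C p.
Proof.
move=> mn sC C1 CE; apply: linspan_min => // _ [c hc ->].
have [|a0 ea] := @assig_surj n k m c; first by move=> sl _; apply: hc.
rewrite (eq_mprod F ea); pose Om := {ffun slotT n k m -> 'I_m.+1}.
pose L := undup (flatten [seq msupp (mprod m (assig a)) | a : Om]).
pose A : 'M[F]_(#|Om|, size L) :=
  \matrix_(i, j) (mprod m (assig (enum_val i)))@_(nth 0%MM L j).
have rA : map_mx Num.conj A = A.
  by apply/matrixP => i j; rewrite !mxE -mcoeff_map_mpoly mprod_real.
(* The rows of [A] are the products written in monomials, and row j of [A^T *m A] is [kerc] at the
   j-th monomial; so [B] expresses the products through the kernel coefficients. *)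
have /submxP[B AB] := gram_submx rA.
have outL u a : u \notin L -> (mprod m (assig (a : Om)))@_u = 0.
  move=> uL; apply/eqP; rewrite mcoeff_eq0; apply: contra uL => ua.
  rewrite mem_undup; apply/flattenP; exists (msupp (mprod m (assig a))) => //.
  by apply: map_f; rewrite mem_enum.
have -> : mprod m (assig a0) =
    \sum_(j < size L) B (enum_rank a0) j *: kerc F k m (nth 0%MM L j).
  apply/mpolyP => u; rewrite raddf_sum /=.
  have kercE j : (B (enum_rank a0) j *: kerc F k m (nth 0%MM L j))@_u =
      B (enum_rank a0) j * \sum_(i < #|Om|) A i j * (mprod m (assig (enum_val i)))@_u.
    rewrite mcoeffZ /kerc raddf_sum (reindex_onto enum_val enum_rank) /=; last first.
      by move=> i _; rewrite enum_rankK.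
    congr (_ * _); apply: eq_big => [i|i _]; first by rewrite enum_valK eqxx.
    by rewrite mcoeffZ mxE.
  under eq_bigr do rewrite kercE.
  have [uL|uL] := boolP (u \in L); last first.
    rewrite outL // big1 // => j _; rewrite big1 ?mulr0 // => i _.
    by rewrite outL ?mulr0.
  have ju : (index u L < size L)%N by rewrite index_mem.
  have eu i : (mprod m (assig (enum_val i)))@_u = A i (Ordinal ju).
    by rewrite mxE /= nth_index.
  rewrite -[a0 in LHS]enum_rankK eu {1}AB mxE; apply: eq_bigr => j _.
  by rewrite mxE; congr (_ * _); apply: eq_bigr => i _; rewrite eu mxE.
by apply: subspace_sum => // j _; case: (sC) => _ _; apply; apply: (@kerc_mem _ _ k m mn).
Qed.

Lemma Qs_up m p : (m < n)%N -> Qs k m p -> Qs k m.+1 p.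
Proof.
move=> mn; apply: linspan_sub => _ [c hc ->].
apply: (@graded_mprod F n m.+1 m k c (fun k' => Qs k' m.+1)); [lia|exact: graded_mprod_span| |lia|exact: hc].
move=> j c' jm hc'; have := @Qs_minor_low F n m.+1 m j c'; apply; [lia|lia|].
by move=> s; have := hc' s; lia.
Qed.

Lemma sl_gen_natE m g : (m <= n)%N -> sl_gen k m g ->
  (exists i j, [/\ (1 <= i <= m.+1)%N, (1 <= j <= m.+1)%N, i != j & forall p, g p = natE m i j p]) \/
  (exists i j, [/\ (1 <= i <= m.+1)%N, (1 <= j <= m.+1)%N & forall p, g p = natE m i i p - natE m j j p]).
Proof.
move=> mn; have [eE eH] := @sl_act_natE F n k m mn.
case=> i j im jm => [ij|]; [left|right]; exists i, j; split=> // p; by [apply: eE|apply: eH].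
Qed.

Lemma Usl_stable m W : (m <= n)%N -> stable m (Usl k m W).
Proof.
move=> mn i j p im jm ij; have [eE _] := @sl_act_natE F n k m mn.
apply: (@linspan_min _ _ _ (fun p => Usl k m W (natE m i j p))).
  exact/subspace_natE/linspan_subspace.
move=> q Wq; apply: mem_linspan; rewrite -eE //; apply: wordsS => //.
exact: sl_genE.
Qed.

Lemma x11_pow_graded : (0 < n)%N ->
  @graded F n 1%N (fun k' => linspan (fun p => exists2 i, (i <= k' n)%N & p = x 1 1 ^+ i)).
Proof.
move=> n0; split=> [k'|k1 k2 p q|k1 k2 p].
- by apply: mem_linspan; exists 0%N.
- apply: linspanM => _ _ [i ik ->] [j jk ->]; apply: mem_linspan.
  by exists (i + j)%N; rewrite ?exprD // leq_add.
- move=> /(_ 1%N isT); rewrite /mult subnK // => h.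
  by apply: linspan_sub => _ [i ik ->]; apply: mem_linspan; exists i => //; lia.
Qed.

Lemma minor11 c : minor 1 1 c = x 1 (c 0%N).
Proof. by rewrite /cminor det_mx11 mxE. Qed.

(** The minors are here the entries x_{1,1} and x_{1,2} = -1, so a product of [k n] of them is, up
    to sign, a power of x_{1,1} with exponent at most [k n]. *)
Lemma Vm1_Qs p : (0 < n)%N -> Vm k 1 p <-> Qs k 1 p.
Proof.
move=> n0; split; apply: linspan_min; try exact: linspan_subspace.
  move=> _ [i ik ->]; have gQ := @graded_mprod_span F n 1 n0.
  have x1 : Qs (delta n 1) 1 (x 1 1).
    by rewrite -(minor11 (fun=> 1%N)); apply: Qs_minor.
  apply: (gradedS gQ) (graded_exp i gQ x1) => j j1.
  have -> : j = 1%N by lia.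
  by rewrite /mult /delta subnK // eqxx muln1.
move=> _ [c hc ->]; apply: (@graded_mprod F n 1 1 k c _ n0 (x11_pow_graded n0)) => // j c' j1 hc'.
have -> : j = 1%N by lia.
rewrite minor11 /delta subnK // eqxx.
have [->|->] : c' 0%N = 1%N \/ c' 0%N = 2%N by have := hc' 0%N; lia.
  by apply: mem_linspan; exists 1%N.
by rewrite xE; apply/linspanN/mem_linspan; exists 0%N.
Qed.

(** The span contains V^(m-1) and is stable, so it contains V^(m); conversely V^(m) contains 1 and
    is stable, so [Qs_min] applies. *)
Lemma Vm_Qs m p : (0 < m <= n)%N -> Vm k m p <-> Qs k m p.
Proof.
case: m => // m; elim: m p => [|m IH] p mn; first exact: Vm1_Qs.
have {}IH q : Vm k m.+1 q <-> Qs k m.+1 q by apply: IH; lia.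
have mn' : (m.+2 <= n)%N by lia.
split; last first.
  apply: Qs_min => //; [exact: linspan_subspace| |exact: Usl_stable].
  by apply/mem_linspan/words0/IH/Qs1; lia.
apply: linspan_min => [|q]; first exact: linspan_subspace.
elim=> [w /IH|g q' /(sl_gen_natE mn') [[i [j [im jm _ ->]]]|[i [j [im jm ->]]]] _].
- by apply: Qs_up; lia.
- exact: Qs_natE.
- move=> Qq; rewrite -scaleN1r; apply: linspanD; first exact: Qs_natE.
  exact/linspanZ/Qs_natE.
Qed.

End Module.

(** * The spanning set S_n *)

Section Products.
Variables (F : numFieldType) (n : nat).
Local Notation P := (pring F n).
Local Notation x := (@x F n).
Local Notation minor := (cminor F n).
Local Notation Qs := (@mprod_span F n).
Local Notation Sset := (@Sset F n).
Local Notation kk := (mult n).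
Local Notation delta := (delta n).
Implicit Types (p q : P) (m i j : nat) (k : nat -> nat) (al : exponents n).

Lemma graded_Sset : graded n (fun k => linspan (Sset k)).
Proof.
split=> [k|k1 k2 p q|k1 k2 p h].
- apply: mem_linspan; exists (fun _ _ _ => 0%N).
    by move=> j _; rewrite big1 // => i _; rewrite big1.
  by rewrite /ddprod big1 // => i _; rewrite big1 // => j _; rewrite big1.
- apply: linspanM => _ _ [al1 a1 ->] [al2 a2 ->]; apply: mem_linspan.
  exists (fun i j th => al1 i j th + al2 i j th)%N.
    move=> j jn; apply: leq_trans (leq_add (a1 j jn) (a2 j jn)).
    by rewrite -big_split; apply/eq_leq/eq_bigr => i _; rewrite -big_split.
  rewrite /ddprod -big_split; apply: eq_bigr => i _ /=.
  rewrite -big_split; apply: eq_bigr => j _ /=.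
  by rewrite -big_split; apply: eq_bigr => th _; rewrite exprD.
- apply: linspan_sub => _ [al a ->]; apply: mem_linspan; exists al => // j jn.
  exact: leq_trans (a j jn) (h j jn).
Qed.

Lemma Sset_d i j (th : theta n i j) : (1 <= j <= i)%N -> (i <= n)%N -> J F th ->
  Sset (delta j) (d F th).
Proof.
move=> ji iN Jth; pose T (ij : nat * nat) := theta n ij.1 ij.2.
(* Indicator of the single factor [th]; tagging makes tuples of different types comparable. *)
pose al i' j' (th' : theta n i' j') : nat :=
  Tagged T (th' : T (i', j')) == Tagged T (th : T (i, j)).
have al0 i' j' th' : (i', j') != (i, j) -> al i' j' th' = 0%N.
  by move=> ne; rewrite /al; case: eqP => // /(congr1 tag) /= e; rewrite e eqxx in ne.
have al1 th' : al i j th' = (th' == th) by rewrite /al eq_Tagged.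
exists al.
  move=> j' j'n; have [->|ne] := eqVneq j' j; last first.
    rewrite big1 // => i' _; rewrite big1 // => th' _; rewrite al0 //.
    by rewrite xpair_eqE (negPf ne) andbF.
  rewrite -/(kk (delta j) j) kk_delta ?eqxx; [|lia|lia].
  have ir : i \in index_iota j n.+1 by rewrite mem_index_iota; lia.
  rewrite (bigD1_seq i ir (iota_uniq _ _)) /= [X in (_ + X)%N]big1 => [|i' ne]; last first.
    by rewrite big1 // => th' _; rewrite al0 // xpair_eqE (negPf ne).
  rewrite addn0 (bigD1 th) //= al1 eqxx big1 // => th' /andP[_ ne].
  by rewrite al1 (negPf ne).
have ir : i \in index_iota 1 n.+1 by rewrite mem_index_iota; lia.
have jr : j \in index_iota 1 i.+1 by rewrite mem_index_iota; lia.
rewrite /ddprod (bigD1_seq i ir (iota_uniq _ _)) /=.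
rewrite [X in _ * X]big1 => [|i' ne]; last first.
  rewrite big1 // => j' _; rewrite big1 // => th' _.
  by rewrite al0 // xpair_eqE (negPf ne).
rewrite mulr1 (bigD1_seq j jr (iota_uniq _ _)) /=.
rewrite [X in _ * X]big1 => [|j' ne]; last first.
  by rewrite big1 // => th' _; rewrite al0 // xpair_eqE (negPf ne) andbF.
rewrite mulr1 (bigD1 th) //= al1 eqxx expr1 big1 ?mulr1 // => th' /andP[_ ne].
by rewrite al1 (negPf ne).
Qed.

Lemma Sset_minor_low i j c : (1 <= j <= i)%N -> (i <= n)%N ->
  (forall s, (s <= i - j)%N -> (1 <= c s <= n)%N) ->
  linspan (Sset (delta j)) (minor i j c).
Proof.
move=> ji iN hc; have cP (b : 'I_(i - j).+1) : ((c b).-1 < n)%N.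
  by have := hc b; have := ltn_ord b; lia.
pose th : theta n i j := [ffun b => Ordinal (cP b)].
have -> : minor i j c = d F th.
  congr (\det _); apply/matrixP => a b; rewrite !mxE ffunE /= prednK //.
  by have := hc b; have := ltn_ord b; lia.
have [->|nz] := eqVneq (d F th) 0; first exact: linspan0.
by apply: mem_linspan; apply: Sset_d.
Qed.

(** Without a column n+1 this is some d_{n,j}. Otherwise expanding that column leaves, up to sign, a
    minor on the rows [j..n-1]: it is some d_{n-1,j}, or 1 when j = n, or 0 when column n+1 occurs
    twice. *)
Lemma Sset_minor j c : (1 <= j <= n)%N -> (forall s, (1 <= c s <= n.+1)%N) ->
  linspan (Sset (delta j)) (minor n j c).
Proof.
move=> jn hc; have [h|] := boolP [forall s : 'I_(n - j).+1, (c s <= n)%N].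
  apply: Sset_minor_low => // s sn; move/forallP/(_ (Ordinal (sn : s < (n - j).+1)%N)): h.
  by have := hc s => /=; lia.
rewrite negb_forall => /existsP[[s sN] /= hs].
have cs : c s = (j + (n - j)).+1 by have := hc s; lia.
rewrite -[minor n j c]/(minorN F n (n - j).+1 j c) (@minorN_col_last _ _ _ _ _ s) //.
rewrite -signr_odd; set e := odd _.
suff H : linspan (Sset (delta j)) (minorN F n (n - j) j (fun b => c (bump s b))).
  by case: e; rewrite ?expr0 ?expr1 ?mul1r ?mulN1r //; apply: linspanN.
case E : (n - j)%N => [|N].
  by rewrite /minorN det_mx00; apply: (graded1 graded_Sset).
have EN : N.+1 = (n.-1 - j).+1 by lia.
have [h|] := boolP [forall b : 'I_N.+1, (c (bump s b) <= n)%N].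
  rewrite EN; apply: (@Sset_minor_low n.-1 j) => [||b bn]; [lia|lia|].
  have bN : (b < N.+1)%N by lia.
  by move/forallP/(_ (Ordinal bN)): h => /=; have := hc (bump s b); lia.
rewrite negb_forall => /existsP[[b bN] /= hb].
by rewrite (@minorN_col0 _ _ _ _ _ b) //; [exact: linspan0|lia].
Qed.

(** A factor d_{i,j} has weight [delta j] whatever i is, so the multiplicity at j is the sum that
    [admissible] bounds. *)
Lemma graded_ddprod m k al G : graded m G -> (m <= n)%N ->
  (forall i j (th : theta n i j), (1 <= j <= i)%N -> (i <= n)%N -> G (delta j) (d F th)) ->
  admissible F k al -> G k (ddprod F al).
Proof.
move=> gG mn Gd adm.
have H : G (fun t => \sum_(i <- index_iota 1 n.+1) \sum_(j <- index_iota 1 i.+1)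
    \sum_(th : theta n i j | J F th) al i j th * delta j t)%N (ddprod F al).
  apply: (graded_prod gG) => i; rewrite mem_index_iota => iN _.
  apply: (graded_prod gG) => j; rewrite mem_index_iota => ji _.
  apply: (graded_prod gG) => th _ _; apply: (graded_exp _ gG).
  by apply: Gd; lia.
apply: (gradedS gG) H => j jm; apply: leq_trans (adm j _); last by lia.
have E i : (1 <= i <= n)%N -> (\sum_(1 <= j' < i.+1) \sum_(th : theta n i j' | J F th) al i j' th * delta j' (n - j + 1)
   = if j <= i then \sum_(th : theta n i j | J F th) al i j th else 0)%N.
  move=> iN; have dE j' : (j' <= i)%N -> delta j' (n - j + 1)%N = (j == j').
    by move=> j'i; rewrite -/(kk (delta j') j) kk_delta //; lia.
  case: leqP => ji; last first.
    rewrite big_nat big1 // => j' jj; rewrite big1 // => th _; rewrite dE; last by lia.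
    have -> : j == j' = false by lia.
    by rewrite muln0.
  have jr : j \in index_iota 1 i.+1 by rewrite mem_index_iota; lia.
  rewrite (bigD1_seq j jr (iota_uniq _ _)) /= big_nat_cond [X in (_ + X)%N]big1 ?addn0.
    by apply: eq_bigr => th _; rewrite dE // eqxx muln1.
  move=> j' /andP[j'i ne]; rewrite big1 // => th _; rewrite dE; last by lia.
  by rewrite eq_sym (negPf ne) muln0.
rewrite /mult (@big_cat_nat _ _ _ j) /=; [|lia|lia].
rewrite big_nat big1 ?add0n => [|i ij]; last by rewrite E; [case: leqP; lia|lia].
apply/eq_leq; apply: eq_big_nat => i ij; rewrite E; last by lia.
by have -> : (j <= i)%N by lia.
Qed.

Lemma Sset_Qs k p : linspan (Sset k) p <-> Qs k n p.
Proof.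
split; last first.
  apply: linspan_sub => _ [c hc ->].
  by apply: (@graded_mprod F n n n k c _ (leqnn n) graded_Sset) => // [j c' jn hc'|]; [exact: Sset_minor|lia].
apply: linspan_sub => _ [al adm ->].
apply: (graded_ddprod (graded_mprod_span F (leqnn n))) adm => // i j th ji iN.
pose c s := (if insub s is Some b then (th b).+1 else 1)%N.
have -> : d F th = minor i j c.
  by congr (\det _); apply/matrixP => a b; rewrite !mxE /c valK.
apply: Qs_minor_low => // [|s]; first by lia.
by rewrite /c; case: insubP => // b _ _; have := ltn_ord (th b); lia.
Qed.

End Products.

(** * The degree in the last row *)

Section LastRow.
Variables (F : numFieldType) (n : nat).
Local Notation P := (pring F n).
Local Notation x := (@x F n).
Local Notation minor := (cminor F n).
Local Notation Qs := (@mprod_span F n).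
Local Notation delta := (delta n).
Implicit Types (p q : P) (m i j : nat) (k : nat -> nat) (al : exponents n).

Lemma last_row_polyP q :
  last_row_poly q <-> q \is 0%N.-homog for @rowdeg n (predC1 n).
Proof.
split=> [h|/dhomogP h u uq v vn].
  by apply/dhomogP => u uq; rewrite /= /rowdeg big1 // => v vn; apply: h uq _ vn.
by have /eqP := h u uq; rewrite /= /rowdeg (bigD1 v) //= addn_eq0 => /andP[/eqP].
Qed.

Lemma last_row_homogP r p : last_row_homog r p <-> p \is r.-homog for @rowdeg n (pred1 n).
Proof. by split=> [h|/dhomogP h]; [apply/dhomogP => u /h | move=> u /h]. Qed.

Definition Mgen k p := exists q w, [/\ last_row_poly q, Qs k n.-1 w & p = q * w].

Lemma graded_Mgen : (0 < n)%N -> graded n (fun k => linspan (Mgen k)).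
Proof.
move=> n0; have gQ := @graded_mprod_span F n n.-1 (leq_pred n).
split=> [k|k1 k2 p q|k1 k2 p h].
- apply: mem_linspan; exists 1, 1; split; rewrite ?mulr1 //; last exact: (graded1 gQ).
  exact/last_row_polyP/dhomog1.
- apply: linspanM => _ _ [q1 [w1 [h1 Q1 ->]]] [q2 [w2 [h2 Q2 ->]]].
  apply: mem_linspan; exists (q1 * q2), (w1 * w2); split; last by rewrite mulrACA.
    by apply/last_row_polyP; rewrite -[0%N]/(0 + 0)%N dhomogM //; apply/last_row_polyP.
  exact: (gradedM gQ).
- apply: linspan_sub => _ [q [w [hq Qw ->]]]; apply: mem_linspan; exists q, w; split=> //.
  by apply: (gradedS gQ) Qw => j jn; apply: h; lia.
Qed.

Lemma last_row_poly_x (c : nat) : last_row_poly (x n c).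
Proof.
by apply/last_row_polyP; have := @x_dhomog F n (predC1 n) n c; rewrite /= eqxx; apply.
Qed.

(** Expand along row n: each term is an entry of that row times a minor on the rows [j..n-1], which
    vanishes if it uses column n+1 and otherwise belongs to V^(n-1) for the weight [delta j]. *)
Lemma Mgen_minor j c : (1 <= j <= n)%N -> (forall s, 1 <= c s <= n.+1)%N ->
  linspan (Mgen (delta j)) (minor n j c).
Proof.
move=> jn hc; rewrite -[minor n j c]/(minorN F n (n - j).+1 j c) minorN_last_row.
apply: linspan_sum => -[s sN] _ /=; rewrite -signr_odd; set e := odd _.
suff H : linspan (Mgen (delta j)) (x (j + (n - j)) (c s) *
    minorN F n (n - j) j (fun b => c (bump s b))).
  by case: e; rewrite ?expr0 ?expr1 ?mul1r ?mulN1r //; apply: linspanN.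
rewrite subnKC; last by lia.
apply: mem_linspan; exists (x n (c s)), (minorN F n (n - j) j (fun b => c (bump s b))).
split=> //; first exact: last_row_poly_x.
have gQ := @graded_mprod_span F n n.-1 (leq_pred n).
case E : (n - j)%N => [|N]; first by rewrite /minorN det_mx00; apply: (graded1 gQ).
have [h|] := boolP [forall b : 'I_N.+1, (c (bump s b) <= n)%N]; last first.
  rewrite negb_forall => /existsP[[b bN] /= hb].
  by rewrite (@minorN_col0 _ _ _ _ _ b) //; [exact: linspan0|lia].
have EN : N.+1 = (n.-1 - j).+1 by lia.
rewrite EN -[minorN _ _ _ _ _]/(minor n.-1 j (fun b => c (bump s b))).
have -> : minor n.-1 j (fun b => c (bump s b)) =
    minor n.-1 j (fun b => minn (c (bump s b)) n).
  apply: eq_minor => b bn; have bN : (b < N.+1)%N by lia.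
  by move/forallP/(_ (Ordinal bN)): h => /= /minn_idPl.
by apply: Qs_minor => [||b]; [lia|lia|have := hc (bump s b); lia].
Qed.

(** As the columns of Theta are at most n, row n of the matrix consists of variables and never of
    the entry -1. *)
Lemma d_dhomog i j (th : theta n i j) : (1 <= j <= i)%N -> (i <= n)%N ->
  d F th \is (i == n : nat).-homog for @rowdeg n (pred1 n).
Proof.
move=> ji iN; pose c s := (if insub s is Some b then (th b).+1 else 1)%N.
have -> : d F th = minor i j c.
  by congr (\det _); apply/matrixP => a b; rewrite !mxE /c valK.
have cn s : (0 < c s <= n)%N.
  by rewrite /c; case: insubP => // [b _ _|_]; [have := ltn_ord (th b)|]; lia.
have := @minor_dhomog F n (pred1 n) i j c.
have -> : (\sum_(a < (i - j).+1) pred1 n (j + a)%N = (i == n : nat))%N.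
  rewrite big_ord_recr /= subnKC; last by lia.
  rewrite big1 // => a _; have := ltn_ord a => aij.
  by apply/eqP; rewrite eqb0; lia.
by apply=> [l s _ /eqP -> _|]; [have := cn s; lia|lia].
Qed.

Lemma ddprod_dhomog al : (0 < n)%N ->
  ddprod F al \is (last_row_deg F al).-homog for @rowdeg n (pred1 n).
Proof.
move=> n0.
have H : ddprod F al \is (\sum_(i <- index_iota 1 n.+1) \sum_(j <- index_iota 1 i.+1)
    \sum_(th : theta n i j | J F th) (i == n) * al i j th)%N.-homog for @rowdeg n (pred1 n).
  apply: dhomog_bigprod => i; rewrite mem_index_iota => iN _.
  apply: dhomog_bigprod => j; rewrite mem_index_iota => ji _.
  apply: dhomog_bigprod => th _ _; apply: dhomogMn.
  by apply: d_dhomog; lia.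
suff <- : (\sum_(i <- index_iota 1 n.+1) \sum_(j <- index_iota 1 i.+1)
    \sum_(th : theta n i j | J F th) (i == n) * al i j th = last_row_deg F al)%N by [].
rewrite big_nat_recr //= big_nat_cond big1 ?add0n => [|i /andP[iN _]]; last first.
  have -> : (i == n) = false by lia.
  by rewrite big1 // => j _; rewrite big1.
apply: eq_bigr => j _; apply: eq_bigr => th _.
by rewrite eqxx mul1n.
Qed.

End LastRow.

Lemma Mbar_spanned (F : numClosedFieldType) (n : nat) (k : nat -> nat) : (2 <= n)%N ->
  (forall p : pring F n, Mbar k p <-> linspan (Sset k) p) /\
  (forall (r : nat) (p : pring F n),
     Mbar_homog k r p <-> linspan (Sset_homog k r) p).
Proof.
move=> n2; have n0 : (0 < n)%N by lia.
have MS (p : pring F n) : Mbar k p <-> linspan (Sset k) p.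
  have nn : (0 < n <= n)%N by lia.
  by split=> [/(Vm_Qs k p nn)/Sset_Qs | /Sset_Qs/(Vm_Qs k p nn)].
split=> // r p; split.
  (* [p] equals its own component of degree r; in a combination of homogeneous products, taking this
     component keeps those of degree r and kills the others. *)
  move=> [/MS Sp [_ /last_row_homogP/pihomog_dE <-]].
  move: Sp => [l [a [g [Sg ->]]]]; rewrite raddf_sum; apply: linspan_sum => t _ /=.
  rewrite linearZ /=; apply: linspanZ; have [al adm ->] := Sg t.
  have al_hom := ddprod_dhomog F al n0.
  have [<-|ne] := eqVneq (last_row_deg F al) r.
    by rewrite pihomog_dE //; apply: mem_linspan; exists al.
  by rewrite (pihomog_ne0 ne al_hom); apply: linspan0.
have SH q : Sset_homog k r q -> Sset k q by case=> al [adm _ ->]; exists al.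
move=> hp; split; [|split].
- by apply/MS; apply: linspan_sub hp => q /SH; apply: mem_linspan.
- have : linspan (Sset k) p by apply: linspan_sub hp => q /SH; apply: mem_linspan.
  move/Sset_Qs; apply: linspan_sub => _ [c hc ->].
  have : linspan (Mgen k) (mprod F n k n c).
    apply: (@graded_mprod F n n n k c _ (leqnn n) (graded_Mgen F n0)) => //; last by lia.
    by move=> j c' jn hc'; apply: Mgen_minor.
  apply: linspan_sub => _ [q [w [hq Qw ->]]]; apply: mem_linspan; exists q, w; split=> //.
  by apply/Vm_Qs => //; lia.
- move: hp; apply: linspan_min.
    split=> [|p1 p2 /last_row_homogP h1 /last_row_homogP h2|c p1 /last_row_homogP h1].
    + exact/last_row_homogP/rpred0.
    + exact/last_row_homogP/rpredD.
    + exact/last_row_homogP/rpredZ.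
  by move=> _ [al [_ <- ->]]; apply/last_row_homogP/ddprod_dhomog.
Qed.

Local Close Scope ring_scope.

Theorem theorem2p4 (R : realType) (n : nat) (k : nat -> nat) (hn : 2 <= n) :
  (forall p : pring R[i]%C n, Mbar k p <-> linspan (Sset k) p) /\
  (forall (r : nat) (p : pring R[i]%C n),
     Mbar_homog k r p <-> linspan (Sset_homog k r) p).
Proof. exact: (@Mbar_spanned R[i]%C n k hn). Qed.
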